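(* Let $\mu>0$ and $k_0,k_1\in\mathbb{R}$ be fixed. There exists a constant $C>0$, independent of $L\ge1$, such that for any $\mathbf{u}\in\mathcal{W}_L$, $$\|\mathbf{u}\|^2_{L^\infty(\Omega_L)}\le C\|\mathbf{u}\|_{L^2(\Omega_L)}\|\mathbf{u}\|_{H^2(\Omega_L)}.$$
   Context: For $L\ge1$, $\Omega_L:=(-L,L)\times(0,1)\subset\mathbb{R}^2$; $\mathbf{n}$ is the unit outer normal and $\tau$ a unit tangent vector on (the sides of) $\partial\Omega_L$; $\mathbb{D}(\mathbf{v})=\frac12(\nabla\mathbf{v}+\nabla^T\mathbf{v})$. The slip coefficient $k$ on $\partial\Omega_L$ is given by $k(x,1)=k_1$, $k(x,0)=k_0$, $k(-L,y)=k(L,y)=0$. Set $\mathbf{V}_L:=\{\mathbf{v}\in H^1(\Omega_L)^2:\nabla\cdot\mathbf{v}=0,\ \mathbf{v}\cdot\mathbf{n}=0\text{ on }\partial\Omega_L\}$ and $\mathcal{W}_L:=\{\mathbf{v}\in\mathbf{V}_L\cap H^2(\Omega_L)^2: 2\mu\mathbb{D}(\mathbf{v})\mathbf{n}\cdot\tau=k(x,y)\mathbf{v}\cdot\tau\text{ on }\partial\Omega_L\}$. *)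

(* Defs.v *)
From HB Require Import structures.
From mathcomp Require Import all_boot all_order all_algebra.
From mathcomp Require Import all_classical all_reals all_analysis.
Import Order.TTheory GRing.Theory Num.Theory.
Import numFieldNormedType.Exports.

Set Implicit Arguments.
Unset Strict Implicit.
Unset Printing Implicit Defensive.

Local Open Scope classical_set_scope.
Local Open Scope ring_scope.

Section lebesgue_space.
Context {R : realType}.

Definition L2 d (T : measurableType d) (mu : {measure set T -> \bar R})
    (D : set T) (f : T -> R) : Prop :=
  (f \_ D) \in Lfun mu 2%:E.

Definition L2norm d (T : measurableType d) (mu : {measure set T -> \bar R})
    (D : set T) (f : T -> R) : \bar R :=
  'N[mu]_2%:E[EFin \o (f \_ D)].

Definition Loonorm d (T : measurableType d) (mu : {measure set T -> \bar R})
    (D : set T) (f : T -> R) : \bar R :=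
  'N[mu]_+oo%E[EFin \o (f \_ D)].

End lebesgue_space.

Section plane.
Context {R : realType}.

Definition coord2 (i : 'I_2) (p : R * R) : R := if i == ord0 then p.1 else p.2.

Definition e_ (i : 'I_2) : R * R := if i == ord0 then (1, 0) else (0, 1).

Definition leb1 : {measure set (measurableTypeR R) -> \bar R} :=
  @lebesgue_measure R.

Definition leb2 :
    {measure set (measurableTypeR R * measurableTypeR R) -> \bar R} :=
  (@lebesgue_measure R \x @lebesgue_measure R)%E.

Definition smooth (phi : R * R -> R) : Prop :=
  forall s : seq 'I_2,
    let dphi := foldr (fun i psi => 'D_(e_ i) psi) phi s in
    continuous dphi /\ forall i x, derivable dphi x (e_ i).

Definition test_function (Om : set (R * R)) (phi : R * R -> R) : Prop :=
  smooth phi /\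
  exists K, [/\ compact K, K `<=` Om & forall x, ~ K x -> phi x = 0].

(* g is the distributional derivative of f in direction i, and is in L^2. *)
Definition weak_partial (Om : set (R * R)) (i : 'I_2) (f g : R * R -> R) :
    Prop :=
  L2 leb2 Om g /\
  forall phi, test_function Om phi ->
    (\int[leb2]_(x in Om) (f x * 'D_(e_ i) phi x) =
     - \int[leb2]_(x in Om) (g x * phi x))%R.

(* A representative of the weak derivative (unique almost everywhere); it is
   the junk value 0 when there is no weak derivative in L^2. *)
Definition wD (Om : set (R * R)) (i : 'I_2) (f : R * R -> R) : R * R -> R :=
  xget (cst 0) [set g | weak_partial Om i f g].

Definition sobolev1 (Om : set (R * R)) (f : R * R -> R) : Prop :=
  L2 leb2 Om f /\ forall i, exists g, weak_partial Om i f g.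

Definition sobolev2 (Om : set (R * R)) (f : R * R -> R) : Prop :=
  sobolev1 Om f /\ forall i, sobolev1 Om (wD Om i f).

Definition vnorm (u : 'I_2 -> R * R -> R) (x : R * R) : R :=
  Num.sqrt (\sum_(i < 2) u i x ^+ 2).

(* The sum over i <= j counts each second-order multi-index once. *)
Definition H2norm (Om : set (R * R)) (u : 'I_2 -> R * R -> R) : \bar R :=
  ((\sum_(m < 2)
     (L2norm leb2 Om (u m) `^ 2
      + \sum_(i < 2) L2norm leb2 Om (wD Om i (u m)) `^ 2
      + \sum_(i < 2) \sum_(j < 2 | (i <= j)%N)
          L2norm leb2 Om (wD Om j (wD Om i (u m))) `^ 2)) `^ 2^-1)%E.

End plane.

Section rectangle.
Context {R : realType}.

Definition Omega (L : R) : set (R * R) := `]- L, L[ `*` `]0, 1[.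

Inductive side := Bottom | Top | Left | Right.

Definition side_dom (L : R) (s : side) : set R :=
  match s with Bottom | Top => `]- L, L[ | Left | Right => `]0, 1[ end.

Definition side_pt (L : R) (s : side) (t : R) : R * R :=
  match s with
  | Bottom => (t, 0) | Top => (t, 1) | Left => (- L, t) | Right => (L, t)
  end.

Definition normal (s : side) : R * R :=
  match s with
  | Bottom => (0, -1) | Top => (0, 1) | Left => (-1, 0) | Right => (1, 0)
  end.

Definition tangent (s : side) : R * R := (- (normal s).2, (normal s).1).

Definition slip (k0 k1 : R) (s : side) : R :=
  match s with Bottom => k0 | Top => k1 | Left | Right => 0 end.

(* The trace operator is the continuous extension to H^1 of the restriction to
   the boundary of functions smooth up to the boundary, with values in L^2 of
   the boundary (each side carries its arc length). *)
Definition is_trace (L : R) (f g : R * R -> R) : Prop :=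
  (forall s, L2 leb1 (side_dom L s) (g \o side_pt L s)) /\
  exists phi : nat -> R * R -> R,
    [/\ forall n, smooth (phi n),
        L2norm leb2 (Omega L) (phi n \- f) @[n --> \oo] --> 0%E,
        forall i, L2norm leb2 (Omega L) ('D_(e_ i) (phi n) \- wD (Omega L) i f)
          @[n --> \oo] --> 0%E
      & forall s, L2norm leb1 (side_dom L s) ((phi n \- g) \o side_pt L s)
          @[n --> \oo] --> 0%E].

(* A representative of the trace; every f in H^1 has one, unique almost
   everywhere on the boundary. *)
Definition trace (L : R) (f : R * R -> R) : R * R -> R :=
  xget (cst 0) [set g | is_trace L f g].

Definition in_V (L : R) (v : 'I_2 -> R * R -> R) : Prop :=
  [/\ forall i, sobolev1 (Omega L) (v i),
      {ae leb2, forall x, Omega L x ->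
        \sum_(i < 2) wD (Omega L) i (v i) x = 0}
    & forall s, {ae leb1, forall t, side_dom L s t ->
        \sum_(i < 2) trace L (v i) (side_pt L s t) * coord2 i (normal s) = 0}].

Definition symgrad (L : R) (v : 'I_2 -> R * R -> R) (i j : 'I_2)
    (x : R * R) : R :=
  2^-1 * (wD (Omega L) j (v i) x + wD (Omega L) i (v j) x).

Definition in_W (mu k0 k1 L : R) (v : 'I_2 -> R * R -> R) : Prop :=
  [/\ in_V L v,
      forall i, sobolev2 (Omega L) (v i)
    & forall s, {ae leb1, forall t, side_dom L s t ->
        2 * mu * (\sum_(i < 2) \sum_(j < 2)
          trace L (symgrad L v i j) (side_pt L s t)
          * coord2 j (normal s) * coord2 i (tangent s)) =
        slip k0 k1 s *
          \sum_(i < 2) trace L (v i) (side_pt L s t) * coord2 i (tangent s)}].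

End rectangle.

(* Main.v *)
(** This is Agmon's inequality for each component [f] of [u], proved up to the
    boundary without an extension operator.

    Let [h] be smooth on the line with [h x = 0] for [x <= 0] and [h x = x] for
    [x >= 1].  The kernels [k_s = (s h(x / s))''] form a one-sided approximate
    identity with vanishing first moment, and [k_s - k_r] is the second derivative
    of a function supported in [[0, r]] and bounded by [2 r], uniformly in
    [s <= r].  Expanding
      [k_s k_t = k_r k_r + (k_s - k_r) k_r + k_r (k_t - k_r) + (k_s - k_r) (k_t - k_r)]
    in the two variables and integrating by parts against [f], Cauchy-Schwarz bounds
    the average of [f] against the kernel [k_s k_t] placed at a corner of a square of
    side [r] by [C (|f| / r + r |D^2 f|)], uniformly in [s, t <= r].  One-sidedness
    allows the corner to be any point of the rectangle, provided the square
    points inwards.  Letting [s] and then [t] tend to 0 (Lebesgue differentiation in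
    each variable) gives the same bound for [|f|] almost everywhere, and
    [r = (|f| / |f|_{H^2})^(1/2) / 4] concludes. *)

Require Import Defs.
From mathcomp Require Import all_boot all_order all_algebra.
From mathcomp Require Import all_classical all_reals all_analysis.
From mathcomp Require Import measurable_realfun ess_sup_inf ring lra.
Import Order.TTheory GRing.Theory Num.Theory.
Import numFieldNormedType.Exports.
Local Open Scope classical_set_scope.
Local Open Scope ring_scope.

Set Implicit Arguments.
Unset Strict Implicit.
Unset Printing Implicit Defensive.

(** * Smooth functions on the line *)

Section smooth_line.
Context {R : realType}.
Implicit Types (f g : R -> R) (n : nat).

(** Derivatives are exhibited as functions rather than computed by iteration, so that closure under
    sums, products and inverses is an induction on [n]. *)
Fixpoint Ck n f : Prop :=
  if n is m.+1 then
    exists g, (forall x, is_derive x (1 : R) f (g x)) /\ Ck m g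
  else True.

Definition smooth_line f := forall n, Ck n f.

Lemma CkW n f : Ck n.+1 f -> Ck n f.
Proof.
elim: n f => [//|n IH] f [g [fg Cg]].
by exists g; split=> //; exact: IH.
Qed.

Lemma is_derive_fun_uniq f g1 g2 :
  (forall x, is_derive x (1 : R) f (g1 x)) ->
  (forall x, is_derive x (1 : R) f (g2 x)) -> g1 = g2.
Proof.
move=> h1 h2; apply/funext => x.
by rewrite -(@derive_val _ _ _ _ _ _ _ (h1 x)) (@derive_val _ _ _ _ _ _ _ (h2 x)).
Qed.

Lemma smooth_line_derive f g :
  (forall x, is_derive x (1 : R) f (g x)) -> smooth_line f -> smooth_line g.
Proof.
move=> fg sf n; have [g' [fg' Cg']] := sf n.+1.
by rewrite (is_derive_fun_uniq fg fg').
Qed.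

Lemma smooth_line_is_derive f : smooth_line f ->
  exists2 g, smooth_line g & forall x, is_derive x (1 : R) f (g x).
Proof.
move=> sf; have [g [fg _]] := sf 1%N.
by exists g => //; exact: smooth_line_derive fg sf.
Qed.

Lemma is_derive_continuous f g :
  (forall x, is_derive x (1 : R) f (g x)) -> continuous f.
Proof.
move=> fg x; apply: differentiable_continuous; apply/derivable1_diffP.
by case: (fg x).
Qed.

Lemma smooth_line_continuous f : smooth_line f -> continuous f.
Proof. by move=> /smooth_line_is_derive[g _ /is_derive_continuous]. Qed.

Lemma Ck_cst n (c : R) : Ck n (cst c).
Proof.
by elim: n c => [//|n IH] c; exists (cst 0); split; [move=> x; exact: is_derive_cst|exact: IH].
Qed.

Lemma Ck_id n : Ck n id.
Proof.
case: n => [//|n]; exists (cst 1); split => [x|]; first exact: is_derive_id.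
exact: Ck_cst.
Qed.

Lemma CkD n f g : Ck n f -> Ck n g -> Ck n (fun x => f x + g x).
Proof.
elim: n f g => [//|n IH] f g [f' [ff' Cf']] [g' [gg' Cg']].
exists (fun x => f' x + g' x); split; last exact: IH.
by move=> x; apply: is_deriveD.
Qed.

Lemma CkM n f g : Ck n f -> Ck n g -> Ck n (fun x => f x * g x).
Proof.
elim: n f g => [//|n IH] f g Cf Cg.
move: (Cf) (Cg) => [f' [ff' Cf']] [g' [gg' Cg']].
exists (fun x => f x * g' x + g x * f' x); split.
  by move=> x; apply: is_deriveM.
by apply: CkD; apply: IH => //; exact: CkW.
Qed.

(** The derivative [- f' / f ^ 2] involves only the inverse itself, [f'] and a constant, so the
    induction on [n] closes with [f] fixed. *)
Lemma CkV n f : (forall x, f x != 0) -> Ck n f -> Ck n (fun x => (f x)^-1).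
Proof.
move=> f0; elim: n => [//|n IH] Cf; move: (Cf) => [f' [ff' Cf']].
have IHf := IH (CkW Cf).
exists (fun x => (- 1 * ((f x)^-1 * (f x)^-1)) * f' x); split.
  move=> x; apply: (is_derive_eq (is_deriveV (f0 x) (ff' x))).
  by rewrite /GRing.scale /= mulN1r -invfM -expr2.
by apply: CkM => //; apply: CkM; [exact: Ck_cst|exact: CkM].
Qed.

Lemma is_derive_affine (a b x : R) : is_derive x (1 : R) (fun x => a * x + b) a.
Proof.
have := is_deriveD (is_deriveZ a (is_derive_id x 1)) (is_derive_cst b x 1).
by rewrite addr0 /GRing.scale /= mulr1.
Qed.

Lemma Ck_affine n f (a b : R) : Ck n f -> Ck n (fun x => f (a * x + b)).
Proof.
elim: n f => [//|n IH] f [f' [ff' Cf']].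
exists (fun x => f' (a * x + b) * a); split; last first.
  by apply: CkM; [exact: IH|exact: Ck_cst].
move=> x; apply: (is_derive1_comp (g := fun x => a * x + b)).
exact: is_derive_affine.
Qed.

(** The quotient [f z / z] is at most [C * |z|], so it is a Caratheodory slope continuous at 0;
    division by zero gives it there the value 0 that is wanted. *)
Lemma is_derive0_quadratic f (C : R) : f 0 = 0 ->
  (forall x, `|f x| <= C * x ^+ 2) -> is_derive (0 : R) (1 : R) f 0.
Proof.
move=> f0 fC; apply/is_derive1_caratheodory.
have C0 : 0 <= C by have := fC 1; rewrite expr1n mulr1; exact: le_trans.
exists (fun z => f z / z); split.
- move=> z; rewrite f0 !subr0; have [->|z0] := eqVneq z 0; last by rewrite divfK.
  by rewrite f0 mulr0.
- apply/cvgrPdist_le => e e0; rewrite f0 mul0r.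
  near=> z; rewrite sub0r normrN normrM normfV.
  have [->|z0] := eqVneq z 0; first by rewrite normr0 invr0 mulr0 ltW.
  rewrite ler_pdivrMr ?normr_gt0//; apply: le_trans (fC z) _.
  rewrite -real_normK ?num_real// expr2 mulrA ler_wpM2r//.
  have : `|z| <= e / (C + 1).
    near: z; apply: (@nbhs0_le _ R); rewrite divr_gt0//; lra.
  rewrite ler_pdivlMr; last lra.
  have := normr_ge0 z; nra.
- by rewrite f0 mul0r.
Unshelve. all: by end_near. Qed.

Lemma expRX_le n (t : R) : 0 <= t -> t ^+ n <= n`!%:R * expR t.
Proof.
move=> t0; case: n => [|n].
  by rewrite expr0 fact0 mul1r -expR0 ler_expR.
have := expR_ge1Dxn n t0; have f0 : 0 < (n.+1)`!%:R :> R by rewrite ltr0n fact_gt0.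
rewrite (mulrC _ (expR t)) -ler_pdivrMr// => H; apply: le_trans H; lra.
Qed.

Lemma poly_le_expR (p : {poly R}) :
  exists C, forall t, 0 <= t -> `|p.[t]| <= C * expR t.
Proof.
exists (\sum_(i < size p) `|p`_i| * i`!%:R) => t t0.
rewrite horner_coef mulr_suml; apply: le_trans (ler_norm_sum _ _ _) _.
apply: ler_sum => i _; rewrite normrM -mulrA ler_wpM2l//.
by rewrite ger0_norm ?exprn_ge0// expRX_le.
Qed.

(* This family contains the flat function [expR (- x^-1)] and is stable under
   differentiation, hence consists of smooth functions. *)
Definition flat (p : {poly R}) (x : R) : R :=
  if 0 < x then p.[x^-1] * expR (- x^-1) else 0.

(** With [t = x^-1], the polynomial [t ^ n p(t)] is at most a multiple of [exp(t)]; dividing by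
    [t ^ n exp(t)] gives the bound. *)
Lemma flat_le (p : {poly R}) n : exists C, forall x, `|flat p x| <= C * `|x| ^+ n.
Proof.
have [C HC] := poly_le_expR ('X^n * p); exists (Num.max C 0) => x.
rewrite /flat; case: ifPn => [x0|_]; last first.
  by rewrite normr0 mulr_ge0// ?exprn_ge0// le_max lexx orbT.
have /HC : 0 <= x^-1 by rewrite invr_ge0 ltW.
rewrite hornerM hornerXn !normrM exprVn (gtr0_norm x0) gtr0_norm ?invr_gt0 ?exprn_gt0//.
rewrite (ger0_norm (expR_ge0 _)) expRN -ler_pdivrMr ?expR_gt0// -mulrA.
rewrite -ler_pdivlMl ?invr_gt0 ?exprn_gt0// invrK => H; apply: le_trans H _.
by rewrite mulrC ler_wpM2r ?exprn_ge0 ?le_max ?lexx// ltW.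
Qed.

(** For [x > 0] and [t = x^-1], the chain rule on [p(t) exp(-t)] brings out [- t ^ 2] and gives
    [t ^ 2 (p(t) - p'(t)) exp(-t)]. At 0 the quadratic flatness bound applies. *)
Lemma is_derive_flat (p : {poly R}) x :
  is_derive x (1 : R) (flat p) (flat ('X^2 * (p - p^`())) x).
Proof.
have [x0|x0|->] := ltgtP x 0.
- rewrite {2}/flat ltNge (ltW x0) /=.
  apply: (@near_eq_is_derive _ _ _ (cst 0)).
  by near=> y; rewrite /flat ltNge ifN// negbK ltW//; near: y; exact: lt_nbhsl.
- rewrite {2}/flat x0.
  have dV : is_derive x (1 : R) (fun y : R => y^-1) (- x ^- 2).
    apply: (is_derive_eq (is_deriveV (lt0r_neq0 x0) (is_derive_id x 1))).
    by rewrite /GRing.scale /= mulr1.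
  have d1 : is_derive x (1 : R) (fun y : R => p.[y^-1]) (p^`().[x^-1] * - x ^- 2).
    exact: (is_derive1_comp (f := horner p) (g := fun y : R => y^-1)).
  have d2 : is_derive x (1 : R) (fun y : R => expR (- y^-1)) (expR (- x^-1) * x ^- 2).
    have dN : is_derive x (1 : R) (fun y : R => - y^-1) (x ^- 2).
      exact: (is_derive_eq (is_deriveN dV) (opprK _)).
    exact: (is_derive1_comp (f := expR) (g := fun y : R => - y^-1)).
  have near_flat : \near x, p.[x^-1] * expR (- x^-1) = flat p x.
    by near=> y; rewrite /flat ifT//; near: y; exact: lt_nbhsr.
  apply: (near_eq_is_derive near_flat).
  apply: (is_derive_eq (is_deriveM d1 d2)).
  rewrite /GRing.scale /= hornerM hornerXn hornerD hornerN exprVn.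
  ring.
- rewrite {2}/flat ltxx; have [C HC] := flat_le p 2.
  apply: (@is_derive0_quadratic _ C); first by rewrite /flat ltxx.
  by move=> y; rewrite -[y ^+ 2]real_normK ?num_real.
Unshelve. all: by end_near. Qed.

Lemma smooth_flat p : smooth_line (flat p).
Proof.
move=> n; elim: n p => [//|n IH] p.
by exists (flat ('X^2 * (p - p^`()))); split => [x|]; [exact: is_derive_flat|].
Qed.

(** A smooth transition from 0 to 1: [x] and [1 - x] are never both nonpositive, so the denominator
    is positive. *)
Definition step (x : R) : R := flat 1 x / (flat 1 x + flat 1 (1 - x)).

Lemma flat1_gt0 x : 0 < x -> 0 < flat 1 x.
Proof. by move=> x0; rewrite /flat x0 hornerE mul1r expR_gt0. Qed.

Lemma flat1_ge0 x : 0 <= flat 1 x.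
Proof. by rewrite /flat; case: ifP => // _; rewrite hornerE mul1r expR_ge0. Qed.

Lemma flat_le0 p x : x <= 0 -> flat p x = 0.
Proof. by move=> x0; rewrite /flat ltNge x0. Qed.

Lemma step_den_gt0 x : 0 < flat 1 x + flat 1 (1 - x).
Proof.
have [x0|x0] := ltP 0 x; first by rewrite ltr_pwDl ?flat1_gt0 ?flat1_ge0.
by rewrite ltr_wpDl ?flat1_ge0// flat1_gt0//; lra.
Qed.

Lemma smooth_step : smooth_line step.
Proof.
move=> n; apply: CkM; first exact: smooth_flat.
apply: CkV; first by move=> x; rewrite gt_eqF// step_den_gt0.
apply: CkD; first exact: smooth_flat.
rewrite (_ : (fun x => flat 1 (1 - x)) = (fun x => flat 1 (-1 * x + 1))).
  by apply: Ck_affine; exact: smooth_flat.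
by apply/funext => x; rewrite mulN1r addrC.
Qed.

Lemma step_le0 x : x <= 0 -> step x = 0.
Proof. by move=> x0; rewrite /step flat_le0// mul0r. Qed.

Lemma step_ge1 x : 1 <= x -> step x = 1.
Proof.
move=> x1; have := step_den_gt0 x; rewrite /step (@flat_le0 _ (1 - x)); last lra.
by rewrite addr0 => f0; rewrite divff// gt_eqF.
Qed.

Lemma step_itv x : 0 <= step x <= 1.
Proof.
rewrite /step divr_ge0 ?flat1_ge0 ?(ltW (step_den_gt0 _))//=.
by rewrite ler_pdivrMr ?step_den_gt0// mul1r lerDl flat1_ge0.
Qed.

(** The function [h] of the overview. Its slope passes from 0 to 1, so its second derivative has
    mass one; it is exactly [x] beyond 1, so differences of its rescalings have bounded support. *)
Definition ramp (x : R) : R := x * step x.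

Lemma smooth_ramp : smooth_line ramp.
Proof. by move=> n; apply: CkM; [exact: Ck_id|exact: smooth_step]. Qed.

Lemma ramp_le0 x : x <= 0 -> ramp x = 0.
Proof. by move=> x0; rewrite /ramp step_le0// mulr0. Qed.

Lemma ramp_ge1 x : 1 <= x -> ramp x = x.
Proof. by move=> x0; rewrite /ramp step_ge1// mulr1. Qed.

Lemma ramp_le x : `|ramp x| <= `|x|.
Proof.
rewrite /ramp normrM ler_piMr//; have /andP[? ?] := step_itv x.
by rewrite ger0_norm.
Qed.

End smooth_line.

(** * Tensor products as test functions *)

Section tensor.
Context {R : realType}.
Implicit Types (a b : R -> R) (p : R * R).

Definition tensor a b p : R := a p.1 * b p.2.

(** A directional derivative at [p] depends only on the restriction to the line through [p], so
    one-variable calculus applies. *)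
Lemma is_derive_line (f : R * R -> R) p v (d : R) :
  is_derive (0 : R) (1 : R) (fun h : R => f (h *: v + p)) d ->
  is_derive p v f d.
Proof.
have E : (fun h : R => h^-1 *: ((f \o shift p) (h *: v) - f p)) =
    (fun h : R => h^-1 *: (((fun h : R => f (h *: v + p)) \o shift 0) (h *: 1) -
      f (0 *: v + p))).
  by apply/funext => h; rewrite /= addr0 scale0r add0r [_%:A]mulr1.
by case=> dv dE; split; [rewrite /derivable E|rewrite /derive E].
Qed.

Lemma is_derive_tensor0 a b p (d : R) : is_derive p.1 (1 : R) a d ->
  is_derive p (e_ ord0) (tensor a b) (d * b p.2).
Proof.
move=> ad; apply: is_derive_line.
rewrite (_ : (fun h : R => _) = (fun h : R => b p.2 *: a (1 * h + p.1))); last first.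
  apply/funext => h; rewrite /tensor /e_ /= [in a _]/GRing.scale /= mulr1 mul1r.
  by rewrite [in b _]scaler0 add0r mulrC.
rewrite mulrC; apply: is_deriveZ.
have ad' : is_derive (1 * 0 + p.1) (1 : R) a d by rewrite mulr0 add0r.
have := is_derive1_comp (f := a) (g := fun h : R => 1 * h + p.1) (x := 0) ad'
  (is_derive_affine 1 p.1 0).
by rewrite mulr1.
Qed.

Lemma is_derive_tensor1 a b p (d : R) : is_derive p.2 (1 : R) b d ->
  is_derive p (e_ ord_max) (tensor a b) (a p.1 * d).
Proof.
move=> bd; apply: is_derive_line.
rewrite (_ : (fun h : R => _) = (fun h : R => a p.1 *: b (1 * h + p.2))); last first.
  apply/funext => h; rewrite /tensor /e_ /= [in b _]/GRing.scale /= mulr1 mul1r.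
  by rewrite [in a _]scaler0 add0r.
apply: is_deriveZ.
have bd' : is_derive (1 * 0 + p.2) (1 : R) b d by rewrite mulr0 add0r.
have := is_derive1_comp (f := b) (g := fun h : R => 1 * h + p.2) (x := 0) bd'
  (is_derive_affine 1 p.2 0).
by rewrite mulr1.
Qed.

Lemma continuous_tensor a b :
  continuous a -> continuous b -> continuous (tensor a b).
Proof.
move=> ca cb p; apply: cvgM.
  by apply: continuous_comp; [exact: cvg_fst|exact: ca].
by apply: continuous_comp; [exact: cvg_snd|exact: cb].
Qed.

Lemma derive_tensor a b a' b' (i : 'I_2) :
  (forall x, is_derive x (1 : R) a (a' x)) ->
  (forall x, is_derive x (1 : R) b (b' x)) ->
  forall p, is_derive p (e_ i) (tensor a b)
    ((if i == ord0 then tensor a' b else tensor a b') p).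
Proof.
move=> da db p; have [->|i0] := eqVneq i ord0; first exact: is_derive_tensor0.
rewrite (_ : i = ord_max); first exact: is_derive_tensor1.
by apply/val_inj => /=; case: i i0 => -[|[|]].
Qed.

Lemma smooth_tensor a b :
  smooth_line a -> smooth_line b -> smooth (tensor a b).
Proof.
move=> sa sb s /=.
(* Every iterated partial derivative of a tensor product is again a tensor product of smooth
   factors. *)
have [a' [b' [sa' sb' ->]]] : exists a' b', [/\ smooth_line a', smooth_line b' &
    foldr (fun i psi => 'D_(e_ i) psi) (tensor a b) s = tensor a' b'].
  elim: s => [|i s [a1 [b1 [sa1 sb1 E]]]]; first by exists a, b.
  have [a2 sa2 da] := smooth_line_is_derive sa1.
  have [b2 sb2 db] := smooth_line_is_derive sb1.
  rewrite /= E; exists (if i == ord0 then a2 else a1), (if i == ord0 then b1 else b2).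
  split; try by case: ifP.
  apply/funext => p; rewrite (@derive_val _ _ _ _ _ _ _ (derive_tensor i da db p)).
  by case: ifP.
split; first by apply: continuous_tensor; exact: smooth_line_continuous.
have [a2 _ da] := smooth_line_is_derive sa'.
have [b2 _ db] := smooth_line_is_derive sb'.
by move=> i p; have [] := derive_tensor i da db p.
Qed.

Lemma test_tensor (Om : set (R * R)) a b (l1 u1 l2 u2 : R) :
  smooth_line a -> smooth_line b ->
  (forall x, x \notin `[l1, u1] -> a x = 0) ->
  (forall x, x \notin `[l2, u2] -> b x = 0) ->
  `[l1, u1] `*` `[l2, u2] `<=` Om ->
  test_function Om (tensor a b).
Proof.
move=> sa sb a0 b0 KOm; split; first exact: smooth_tensor.
exists (`[l1, u1] `*` `[l2, u2]); split => //.
  by apply: compact_setX; exact: segment_compact.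
move=> p /= /not_andP[] /negP; rewrite /tensor => np.
  by rewrite a0 ?mul0r.
by rewrite b0 ?mulr0.
Qed.

End tensor.

(** * One-sided kernels with vanishing first moment *)

Section kernel.
Context {R : realType}.
Implicit Types (e c r s x : R).

Definition ramp1 : R -> R := derive1 ramp.
Definition ramp2 : R -> R := derive1 ramp1.

Lemma is_derive_derive1 (f : R -> R) : smooth_line f ->
  forall x, is_derive x (1 : R) f (derive1 f x).
Proof.
move=> /smooth_line_is_derive[g _ fg] x.
by rewrite derive1E (@derive_val _ _ _ _ _ _ _ (fg x)).
Qed.

Lemma smooth_derive1 (f : R -> R) : smooth_line f -> smooth_line (derive1 f).
Proof. by move=> sf; exact: smooth_line_derive (is_derive_derive1 sf) sf. Qed.

Lemma smooth_ramp1 : smooth_line ramp1.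
Proof. exact: smooth_derive1 smooth_ramp. Qed.

Lemma smooth_ramp2 : smooth_line ramp2.
Proof. exact: smooth_derive1 smooth_ramp1. Qed.

(** The strict inequality gives a neighbourhood of [x] on which [ramp] is explicit, and that
    determines the derivative; the next three lemmas proceed likewise. *)
Lemma ramp1_lt0 x : x < 0 -> ramp1 x = 0.
Proof.
move=> x0; rewrite /ramp1 derive1E (@near_eq_derive _ _ _ _ (cst 0 : R -> R)).
  exact: derive_cst.
by near=> y; rewrite ramp_le0// ltW//; near: y; exact: lt_nbhsl.
Unshelve. all: by end_near. Qed.

Lemma ramp1_gt1 x : 1 < x -> ramp1 x = 1.
Proof.
move=> x1; rewrite /ramp1 derive1E (@near_eq_derive _ _ _ _ (id : R -> R)).
  exact: derive_id.
by near=> y; rewrite ramp_ge1// ltW//; near: y; exact: lt_nbhsr.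
Unshelve. all: by end_near. Qed.

Lemma ramp2_lt0 x : x < 0 -> ramp2 x = 0.
Proof.
move=> x0; rewrite /ramp2 derive1E (@near_eq_derive _ _ _ _ (cst 0 : R -> R)).
  exact: derive_cst.
by near=> y; rewrite ramp1_lt0//; near: y; exact: lt_nbhsl.
Unshelve. all: by end_near. Qed.

Lemma ramp2_gt1 x : 1 < x -> ramp2 x = 0.
Proof.
move=> x1; rewrite /ramp2 derive1E (@near_eq_derive _ _ _ _ (cst 1 : R -> R)).
  exact: derive_cst.
by near=> y; rewrite ramp1_gt1//; near: y; exact: lt_nbhsr.
Unshelve. all: by end_near. Qed.

Lemma continuous_segment_bounded (f : R -> R) : continuous f ->
  exists B, forall x, 0 <= x <= 1 -> `|f x| <= B.
Proof.
move=> cf; have cf' : {within `[0, 1], continuous (fun x => `|f x|)}.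
  apply: continuous_subspaceT => x.
  by apply: continuous_comp; [exact: cf|exact: norm_continuous].
by have [t _ Ht] := EVT_max ler01 cf'; exists `|f t| => x x01; exact: Ht.
Qed.

(** Both derivatives are constant on each side of [[0, 1]], and compactness bounds them on it.
    Taking [B] at least 1 later gives [B <= B ^ 2]. *)
Lemma ramp_derivatives_bounded :
  exists B, 1 <= B /\ forall x, `|ramp1 x| <= B /\ `|ramp2 x| <= B.
Proof.
have [B1 H1] := continuous_segment_bounded (smooth_line_continuous smooth_ramp1).
have [B2 H2] := continuous_segment_bounded (smooth_line_continuous smooth_ramp2).
exists (1 + `|B1| + `|B2|).
have := ler_norm B1; have := ler_norm B2.
have := normr_ge0 B1; have := normr_ge0 B2 => ? ? ? ?; split => [|x]; first lra.
have [x0|x0] := ltP x 0.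
  by rewrite ramp1_lt0// ramp2_lt0// normr0; lra.
have [x1|x1] := ltP 1 x.
  by rewrite ramp1_gt1// ramp2_gt1// normr0 normr1; lra.
by have := H1 x; have := H2 x; rewrite x0 x1 => /(_ isT) ? /(_ isT) ?; split; lra.
Qed.

(** One bound is fixed by choice, so that later constants are expressed through it and depend
    neither on the scales nor on the rectangle. *)
Definition ramp_bound : R := xget 1 [set B | 1 <= B /\
  forall x, `|ramp1 x| <= B /\ `|ramp2 x| <= B].

Lemma ramp_boundP : 1 <= ramp_bound /\
  forall x, `|ramp1 x| <= ramp_bound /\ `|ramp2 x| <= ramp_bound.
Proof. exact: xgetPex ramp_derivatives_bounded. Qed.

(* The ramp of scale [s] rising from [c] in the direction [e = 1] or [e = -1];
   [kernel1] and [kernel2] are its first and second derivatives. *)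
Definition kernel0 e c s x := s * ramp (e / s * x + - (e / s * c)).
Definition kernel1 e c s x := e * ramp1 (e / s * x + - (e / s * c)).
Definition kernel2 e c s x := s^-1 * ramp2 (e / s * x + - (e / s * c)).

Lemma is_derive_kernel0 e c s x : s != 0 ->
  is_derive x (1 : R) (kernel0 e c s) (kernel1 e c s x).
Proof.
move=> s0; apply: (is_derive_eq (is_deriveZ s (is_derive1_comp
  (is_derive_derive1 smooth_ramp _) (is_derive_affine _ _ _)))).
by rewrite /GRing.scale /= /kernel1 mulrCA [s * _]mulrCA mulfV// mulr1 mulrC.
Qed.

Lemma is_derive_kernel1 e c s x : e * e = 1 ->
  is_derive x (1 : R) (kernel1 e c s) (kernel2 e c s x).
Proof.
move=> e1; apply: (is_derive_eq (is_deriveZ e (is_derive1_comp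
  (is_derive_derive1 smooth_ramp1 _) (is_derive_affine _ _ _)))).
by rewrite /GRing.scale /= /kernel2 mulrCA (mulrA e) e1 mul1r mulrC.
Qed.

Lemma smooth_kernel2 e c s : smooth_line (kernel2 e c s).
Proof.
move=> n; apply: (CkM (f := cst s^-1)); first exact: Ck_cst.
by apply: Ck_affine; exact: smooth_ramp2.
Qed.

Lemma smooth_kernel1 e c s : smooth_line (kernel1 e c s).
Proof.
move=> n; apply: (CkM (f := cst e)); first exact: Ck_cst.
by apply: Ck_affine; exact: smooth_ramp1.
Qed.

Lemma smooth_kernel0 e c s : smooth_line (kernel0 e c s).
Proof.
move=> n; apply: (CkM (f := cst s)); first exact: Ck_cst.
by apply: Ck_affine; exact: smooth_ramp.
Qed.

(** For [e = 1] or [e = -1] this is the segment from [c] to [c + e * r]; it carries [kernel2 e c s]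
    for every positive [s <= r]. *)
Definition in_seg e c r x := 0 <= e * (x - c) <= r.

(** The kernels have their argument in affine form to fit [Ck_affine]; this form shows the position
    relative to [c] in units of [s]. *)
Let argE e c s x : e / s * x + - (e / s * c) = e * (x - c) / s.
Proof. by rewrite mulrBr mulrBl; congr (_ - _); rewrite mulrAC. Qed.

Lemma kernel2_le e c s x : 0 < s -> `|kernel2 e c s x| <= ramp_bound / s.
Proof.
move=> s0; have [_ /(_ (e / s * x + - (e / s * c)))[_ H]] := ramp_boundP.
rewrite /kernel2 normrM mulrC (gtr0_norm (x := s^-1)) ?invr_gt0//.
by rewrite ler_wpM2r// invr_ge0 ltW.
Qed.

Lemma kernel2_supp e c s x : 0 < s -> ~~ in_seg e c s x -> kernel2 e c s x = 0.
Proof.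
move=> s0; rewrite /in_seg negb_and -!ltNge /kernel2 argE => /orP[] H.
  by rewrite ramp2_lt0 ?mulr0// pmulr_llt0// invr_gt0.
by rewrite ramp2_gt1 ?mulr0// ltr_pdivlMr// mul1r.
Qed.

Lemma in_segS e c s r x : s <= r -> in_seg e c s x -> in_seg e c r x.
Proof. by move=> sr /andP[x0 xs]; rewrite /in_seg x0 (le_trans xs). Qed.

Definition dkernel1 e c s r x := kernel1 e c s x + -1 * kernel1 e c r x.
Definition dkernel0 e c s r x := kernel0 e c s x + -1 * kernel0 e c r x.

Lemma smooth_dkernel1 e c s r : smooth_line (dkernel1 e c s r).
Proof.
move=> n; apply: CkD; first exact: smooth_kernel1.
by apply: (CkM (f := cst (-1))); [exact: Ck_cst|exact: smooth_kernel1].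
Qed.

Lemma smooth_dkernel0 e c s r : smooth_line (dkernel0 e c s r).
Proof.
move=> n; apply: CkD; first exact: smooth_kernel0.
by apply: (CkM (f := cst (-1))); [exact: Ck_cst|exact: smooth_kernel0].
Qed.

Lemma is_derive_dkernel0 e c s r x : s != 0 -> r != 0 ->
  is_derive x (1 : R) (dkernel0 e c s r) (dkernel1 e c s r x).
Proof.
move=> s0 r0; apply: is_deriveD; first exact: is_derive_kernel0.
by apply: is_deriveZ; exact: is_derive_kernel0.
Qed.

Lemma is_derive_dkernel1 e c s r x : e * e = 1 ->
  is_derive x (1 : R) (dkernel1 e c s r) (kernel2 e c s x - kernel2 e c r x).
Proof.
move=> e1; rewrite -[- kernel2 _ _ _ _]mulN1r.
apply: is_deriveD; first exact: is_derive_kernel1.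
by apply: is_deriveZ; exact: is_derive_kernel1.
Qed.

Lemma dkernel1_le e c s r x : e * e = 1 -> `|dkernel1 e c s r x| <= 2 * ramp_bound.
Proof.
move=> e1; have [_ H] := ramp_boundP.
have ne : `|e| = 1 by apply/eqP; rewrite -sqrp_eq1// -normrX expr2 e1 normr1.
have K t : `|kernel1 e c t x| <= ramp_bound.
  by rewrite /kernel1 normrM ne mul1r; case: (H (e / t * x + - (e / t * c))).
rewrite /dkernel1 mulN1r mulrDl mul1r (le_trans (ler_normB _ _))//.
by rewrite lerD.
Qed.

(** Before [c] both slopes are 0 and beyond the segment both are [e], so they cancel although
    neither slope has bounded support. *)
Lemma dkernel1_supp e c s r x : 0 < s -> s <= r ->
  ~~ in_seg e c r x -> dkernel1 e c s r x = 0.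
Proof.
move=> s0 sr; have r0 : 0 < r by exact: lt_le_trans sr.
rewrite /in_seg negb_and -!ltNge /dkernel1 /kernel1 !argE => /orP[] H.
  have N t : 0 < t -> e * (x - c) / t < 0 by move=> t0; rewrite pmulr_llt0 ?invr_gt0.
  by rewrite !ramp1_lt0 ?N// !mulr0 addr0.
rewrite !ramp1_gt1 ?ltr_pdivlMr ?mul1r ?(le_lt_trans sr)//.
by rewrite mulN1r subrr.
Qed.

(** Beyond the segment both ramps equal [e * (x - c)], with no offset depending on the scale; this
    expresses the vanishing first moment of the kernels. *)
Lemma dkernel0_supp e c s r x : 0 < s -> s <= r ->
  ~~ in_seg e c r x -> dkernel0 e c s r x = 0.
Proof.
move=> s0 sr; have r0 : 0 < r by exact: lt_le_trans sr.
rewrite /in_seg negb_and -!ltNge /dkernel0 /kernel0 !argE => /orP[] H.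
  have N t : 0 < t -> e * (x - c) / t <= 0 by move=> t0; rewrite ltW// pmulr_llt0 ?invr_gt0.
  by rewrite !ramp_le0 ?N// !mulr0 addr0.
rewrite !ramp_ge1 ?ler_pdivlMr ?mul1r ?(le_trans sr) ?(ltW H)//.
by rewrite mulN1r ![_ * (_ / _)]mulrC !divfK ?gt_eqF// subrr.
Qed.

(** The bound is free of [s], whence the uniformity as the scale tends to 0. *)
Lemma kernel0_le e c s x : e * e = 1 -> 0 < s -> `|kernel0 e c s x| <= `|e * (x - c)|.
Proof.
move=> e1 s0; rewrite /kernel0 normrM argE (gtr0_norm s0) mulrC -ler_pdivlMr//.
apply: le_trans (ramp_le _) _.
by rewrite normrM (gtr0_norm (x := s^-1)) ?invr_gt0.
Qed.

Lemma dkernel0_le e c s r x : e * e = 1 -> 0 < s -> s <= r ->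
  `|dkernel0 e c s r x| <= 2 * r.
Proof.
move=> e1 s0 sr; have r0 : 0 < r by exact: lt_le_trans sr.
have [/andP[x0 xr]|] := boolP (in_seg e c r x); last first.
  by move=> /dkernel0_supp ->//; rewrite normr0 mulr_ge0// ltW.
rewrite /dkernel0 mulN1r mulrDl mul1r (le_trans (ler_normB _ _))//.
by rewrite lerD// (le_trans (kernel0_le _ _ _ _))// ger0_norm.
Qed.

Lemma in_segP e c r x : e * e = 1 -> in_seg e c r x -> `|x - c| <= r.
Proof.
move=> e1 /andP[x0 xr].
have ne : `|e| = 1 by apply/eqP; rewrite -sqrp_eq1// -normrX expr2 e1 normr1.
by rewrite -[`|_|]mul1r -ne -normrM ger0_norm.
Qed.

End kernel.

(** * Passing to the limit at Lebesgue points *)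

Section support.
Context d (T : measurableType d) (R : realType).
Variable mu : {measure set T -> \bar R}.

Lemma Rintegral_supp (D : set T) (f : T -> R) :
  (forall x, ~ D x -> f x = 0) -> \int[mu]_x f x = \int[mu]_(x in D) f x.
Proof.
move=> fD; rewrite [RHS]Rintegral_mkcond; congr Rintegral; apply/funext => x.
by rewrite patchE; case: ifPn => // /negP xD; apply: fD => Dx; apply: xD; rewrite inE.
Qed.

End support.

Section lebesgue_point.
Context {R : realType}.
Implicit Types (e c q s x y : R) (g : R -> R).
Notation mu := (@lebesgue_measure R).

Lemma sq1_cases e : e * e = 1 -> e = 1 \/ e = -1.
Proof.
move=> /eqP; rewrite -expr2 sqrf_eq1 => /orP[] /eqP; by [left|right].
Qed.

Lemma continuous_kernel2 e c s : continuous (kernel2 e c s).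
Proof. exact: smooth_line_continuous (smooth_kernel2 _ _ _). Qed.

Lemma measurable_kernel2 e c s : measurable_fun (setT : set (measurableTypeR R)) (kernel2 e c s).
Proof. exact: continuous_measurable_fun (@continuous_kernel2 _ _ _). Qed.

(** By the fundamental theorem the integral is the increase of [kernel1], from 0 to 1 if [e = 1] and
    from -1 to 0 if [e = -1]. *)
Lemma integral_kernel2 e c s : e * e = 1 -> 0 < s ->
  \int[mu]_x kernel2 e c s x = 1.
Proof.
(* Twice the support radius puts the endpoints at arguments -2 and 2 of [ramp1], strictly outside
   [[0, 1]], where its values are known. *)
move=> e1 s0; pose I := `[c - 2 * s, c + 2 * s]%classic.
rewrite (Rintegral_supp mu (D := I) (f := kernel2 e c s)); last first.
  move=> x xI; apply: kernel2_supp => //; apply/negP => xs; apply: xI.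
  rewrite /I /= in_itv/=; have := in_segP e1 xs; rewrite ler_norml => /andP[? ?].
  by apply/andP; split; lra.
have ab : c - 2 * s < c + 2 * s by lra.
have dF x : is_derive x (1 : R) (kernel1 e c s) (kernel2 e c s x).
  exact: is_derive_kernel1.
have cF : continuous (kernel1 e c s) by exact: is_derive_continuous dF.
rewrite /Rintegral (@continuous_FTC2 _ _ (kernel1 e c s))//; last 3 first.
- by apply: continuous_subspaceT; exact: continuous_kernel2.
- split; first by move=> x _; case: (dF x).
  + exact/cvg_at_right_filter/cF.
  + exact/cvg_at_left_filter/cF.
- by move=> x _; rewrite derive1E (@derive_val _ _ _ _ _ _ _ (dF x)).
have E k : e / s * (c + k * s) + - (e / s * c) = e * k.
  by rewrite mulrDr addrAC subrr add0r mulrCA -mulrA [_^-1 * _]mulrC mulrCA mulfV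
    ?mulr1 1?mulrC// gt_eqF.
rewrite -EFinB [fine _]/= /kernel1 E (_ : c - 2 * s = c + (-2) * s) ?mulNr// -mulNr E.
have [->|->] := sq1_cases e1.
  by rewrite !mul1r ramp1_gt1 ?ramp1_lt0 ?subr0//; lra.
by rewrite !mulN1r !opprK (ramp1_lt0 (x := - 2)) ?ramp1_gt1 ?oppr0 ?add0r//; lra.
Qed.

(** The kernel has mass one, height at most [ramp_bound / s] and, as [q] is within [s] of [y],
    support in the ball of radius [2 * s] about [y]. Replacing [g] by [g y] under the integral thus
    costs at most [ramp_bound / s] times the length [4 * s] of the ball times the mean deviation. *)
Lemma lebesgue_pt_kernel_le g e q y s (M eps : R) : e * e = 1 -> 0 < s ->
  mu.-integrable setT (EFin \o g) -> `|q - y| < s ->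
  `|\int[mu]_x (g x * kernel2 e q s x)| <= M ->
  (davg g y (2 * s) <= eps%:E)%E ->
  `|g y| <= M + 4 * ramp_bound * eps.
Proof.
move=> e1 s0 ig qy HM Hd.
pose U : set R := ball y (2 * s).
have mU : measurable (U : set (measurableTypeR R)) by exact: measurable_ball.
have muU : mu U = (4 * s)%:E.
  rewrite lebesgue_measure_ball//; last lra.
  by rewrite -mulr_natr; congr (_%:E); lra.
have muUoo : (mu U < +oo)%E by rewrite muU ltry.
have kU x : ~ U x -> kernel2 e q s x = 0.
  move=> xU; apply: kernel2_supp => //; apply/negP => /(in_segP e1) xs; apply: xU.
  rewrite /U /ball /=; have := ler_distD q y x; rewrite (distrC y q) (distrC q x); lra.
have [B1 _] := @ramp_boundP R.
have mk : measurable_fun (U : set (measurableTypeR R)) (kernel2 e q s).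
  exact: measurable_funS (@measurable_kernel2 e q s).
have ik : mu.-integrable U (EFin \o kernel2 e q s).
  apply: measurable_bounded_integrable => //.
  exists (ramp_bound / s); split; first exact: num_real.
  by move=> z zM x _; apply: le_trans (ltW zM); exact: kernel2_le.
have igU : mu.-integrable U (EFin \o g) by exact: integrableS ig.
have bk : [bounded kernel2 e q s x | x in U].
  exists (ramp_bound / s); split; first exact: num_real.
  by move=> z zM x _; apply: le_trans (ltW zM); exact: kernel2_le.
have igk : mu.-integrable U (EFin \o (fun x => g x * kernel2 e q s x)).
  exact: (integrableMl mU igU mk bk).
have icg : mu.-integrable U (EFin \o (fun x => g x - g y)).
  apply: (integrableB mU igU (g := EFin \o cst (g y))).
  apply: measurable_bounded_integrable => //.
  exists `|g y|; split; first exact: num_real.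
  by move=> z zM x _; exact: ltW.
have ick : mu.-integrable U (EFin \o (fun x => (g x - g y) * kernel2 e q s x)).
  exact: (integrableMl mU icg mk bk).
have E : g y = \int[mu]_x (g x * kernel2 e q s x) -
    \int[mu]_(x in U) ((g x - g y) * kernel2 e q s x).
  rewrite (Rintegral_supp mu (D := U)); last by move=> x /kU ->; rewrite mulr0.
  rewrite -RintegralB//.
  have -> : \int[mu]_(x in U) (g x * kernel2 e q s x - (g x - g y) * kernel2 e q s x) =
      \int[mu]_(x in U) (g y * kernel2 e q s x).
    by apply: eq_Rintegral => x _ /=; ring.
  rewrite RintegralZl// -(Rintegral_supp mu (D := U))//.
  by rewrite integral_kernel2// mulr1.
rewrite E; apply: le_trans (ler_normB _ _) _; apply: lerD => //.
apply: le_trans (le_normr_Rintegral mU ick) _.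
have inc : mu.-integrable U (EFin \o (fun x => `|g x - g y|)).
  exact: (integrable_norm icg).
apply: (@le_trans _ _ (\int[mu]_(x in U) (ramp_bound / s * `|g x - g y|))).
  apply: le_Rintegral => //.
  - exact: (integrable_norm ick).
  - exact: (integrableZl mU (ramp_bound / s) inc).
  - by move=> x _; rewrite normrM mulrC ler_wpM2r// kernel2_le.
rewrite RintegralZl//.
move: Hd; rewrite /davg /iavg -/U muU inver gt_eqF ?mulr_gt0//.
have -> : (\int[mu]_(y0 in U) `|((center (g y) \o g) y0)%:E| =
   (\int[mu]_(x in U) `|g x - g y|)%:E)%E.
  by rewrite /Rintegral fineK//; exact: integrable_fin_num.
rewrite -EFinM lee_fin ler_pdivrMl ?mulr_gt0// => Hd.
have : ramp_bound / s * \int[mu]_(x in U) `|g x - g y| <= ramp_bound / s * (4 * s * eps).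
  by rewrite ler_wpM2l// divr_ge0 ?ltW//; lra.
move=> /le_trans; apply; rewrite le_eqVlt; apply/orP; left; apply/eqP.
by field; rewrite gt_eqF.
Qed.

(* Rational centers suffice, so that in the plane the null sets arising from the
   other variable are countably many. *)
Lemma ae_le_of_kernel_le g e (M r : R) (J : set R) : e * e = 1 -> 0 < r -> open J ->
  mu.-integrable setT (EFin \o g) ->
  (forall (q : rat) n, J (ratr q) -> n.+1%:R^-1 <= r ->
    `|\int[mu]_x (g x * kernel2 e (ratr q) n.+1%:R^-1 x)| <= M) ->
  {ae mu, forall y, J y -> `|g y| <= M}.
Proof.
move=> e1 r0 oJ ig H.
have lg : locally_integrable setT g by exact: open_integrable_locally openT ig.
have := lebesgue_differentiation lg.
apply: (@filterS _ _ (ae_filter_ringOfSetsType (@lebesgue_measure R))) => y yg Jy.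
apply/ler_addgt0Pr => eps eps0.
have [B1 _] := @ramp_boundP R.
(* The error [4 * ramp_bound * eta] of the Lebesgue point estimate is then exactly [eps]. *)
pose eta := eps / (4 * ramp_bound).
have eta0 : 0 < eta by rewrite divr_gt0// mulr_gt0//; lra.
have : \forall t \near (0:R)^'+, (davg g y t <= eta%:E)%E.
  have := yg; rewrite /lebesgue_pt => /fine_cvgP[fd /cvgrPdist_lt /(_ _ eta0) dl].
  near=> t; have ft : davg g y t \is a fin_num by near: t.
  rewrite -(fineK ft) lee_fin.
  have : `|0 - fine (davg g y t)| < eta by near: t.
  by rewrite sub0r normrN => /ltW; apply: le_trans; exact: ler_norm.
move=> [d /= d0 Hd].
have d2 : 0 < 2^-1 * d by rewrite mulr_gt0.
(* The scale has to be admissible in the hypothesis, and its double must lie in the range where the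
   mean deviation is at most [eta]. *)
have [n [n1 n2]] : exists n, n.+1%:R^-1 <= r /\ 2 * n.+1%:R^-1 < d.
  near \oo => n; exists n; split.
    by apply/ltW; near: n; exact: near_infty_natSinv_lt (PosNum r0).
  by rewrite -ltr_pdivlMl//; near: n; exact: near_infty_natSinv_lt (PosNum d2).
set s := n.+1%:R^-1 in n1 n2; have s0 : 0 < s by rewrite invr_gt0.
have [q [Jq qy]] : exists q : rat, J (ratr q) /\ `|ratr q - y| < s.
  have oK : open (J `&` ball y s) by apply: openI => //; exact: ball_open.
  have K0 : J `&` ball y s !=set0 by exists y; split => //; exact: ballxx.
  have [z [[Jz zs] [q _ E]]] := dense_rat K0 oK.
  by exists q; rewrite E; split => //; move: zs; rewrite /ball /= distrC.
have := lebesgue_pt_kernel_le e1 s0 ig qy (H q n Jq n1).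
move=> /(_ eta); have -> : 4 * ramp_bound * eta = eps.
  by rewrite /eta mulrC divfK// gt_eqF// mulr_gt0//; lra.
apply; apply: Hd; last by rewrite mulr_gt0.
by rewrite /ball /= sub0r normrN gtr0_norm// mulr_gt0.
Unshelve. all: by end_near. Qed.

End lebesgue_point.

(** * Fubini for real-valued integrals, and null sets by slices *)

Section real_fubini.
Context d1 d2 (T1 : measurableType d1) (T2 : measurableType d2) (R : realType).
Variables (m1 : {sigma_finite_measure set T1 -> \bar R})
          (m2 : {sigma_finite_measure set T2 -> \bar R}).

(** Where the inner integral is infinite its real value is 0 by convention, so it is dominated
    everywhere by the extended one. *)
Lemma integrable_slice (f : T1 * T2 -> R) :
  (m1 \x m2)%E.-integrable setT (EFin \o f) ->
  m1.-integrable setT (EFin \o (fun x => \int[m2]_y f (x, y))).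
Proof.
move=> If; have IF := integrable_fubini_F If.
apply: le_integrable IF => //.
  apply/measurable_EFinP; rewrite /Rintegral.
  apply: (measurableT_comp (f := fine)) => //.
  exact: measurable_fubini_F If.
move=> x _; rewrite /= /Rintegral /fubini_F /=.
by case: integral => //=; rewrite ?normr0 ?leey.
Qed.

(* The inner real integral is the junk value [fine] of an infinite integral on a
   null set, hence the almost everywhere argument. *)
Lemma Rintegral_slice (f : T1 * T2 -> R) (k : T1 -> R) :
  measurable_fun setT k ->
  (m1 \x m2)%E.-integrable setT (EFin \o f) ->
  (m1 \x m2)%E.-integrable setT (EFin \o (fun z => f z * k z.1)) ->
  \int[m1]_x (\int[m2]_y f (x, y) * k x) = \int[(m1 \x m2)%E]_z (f z * k z.1).
Proof.
move=> mk If Ifk; rewrite /Rintegral -integral12_prod_meas1//; congr fine.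
apply: ae_eq_integral => //.
- apply/measurable_EFinP; apply: measurable_funM => //.
  by apply/measurable_EFinP; case/integrableP: (integrable_slice If).
- exact: measurable_fubini_F Ifk.
- apply: filterS (ae_integrable1 If) => x /= Ix _.
  rewrite /fubini_F /=.
  under [RHS]eq_integral do rewrite EFinM.
  rewrite integralZr// EFinM; congr (_ * _)%E.
  by rewrite fineK//; exact: integrable_fin_num.
Qed.

(** The product measure is by definition the integral of the measures of the slices. *)
Lemma negligible_slices (A : set (T1 * T2)) : measurable A ->
  {ae m1, forall x, {ae m2, forall y, ~ A (x, y)}} -> (m1 \x m2)%E A = 0.
Proof.
move=> mA H; rewrite /product_measure1.
have : ae_eq m1 setT (m2 \o xsection A) (cst 0%E).
  apply: filterS H => x Hx _ /=; apply/negligibleP.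
    exact: measurable_xsection.
  apply: negligibleS Hx => y; rewrite /xsection /= inE => Axy /=.
  exact.
move=> /(@ae_eq_integral _ _ _ m1 setT) ->//.
  by rewrite integral0.
exact: measurable_fun_xsection.
Qed.

End real_fubini.

(** * From kernel averages to pointwise bounds in the plane *)

Section plane_kernel.
Context {R : realType}.
Implicit Types (e c s : R).
Notation mu := (@lebesgue_measure R).
Notation T := (measurableTypeR R).

Lemma measurable_kernel2_fst e c s :
  measurable_fun (setT : set (T * T)) (fun z => kernel2 e c s z.1).
Proof.
exact: (measurableT_comp (f := (kernel2 e c s : T -> R))
  (@measurable_kernel2 R e c s) measurable_fst).
Qed.

Lemma measurable_kernel2_snd e c s :
  measurable_fun (setT : set (T * T)) (fun z => kernel2 e c s z.2).
Proof.
exact: (measurableT_comp (f := (kernel2 e c s : T -> R))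
  (@measurable_kernel2 R e c s) measurable_snd).
Qed.

Lemma integrableM_bounded d (U : measurableType d) (m : {measure set U -> \bar R})
    (f k : U -> R) (B : R) :
  m.-integrable setT (EFin \o f) -> measurable_fun setT k ->
  (forall x, `|k x| <= B) -> m.-integrable setT (EFin \o (fun x => f x * k x)).
Proof.
move=> If mk kB; apply: (integrableMl measurableT If mk).
exists B; split; first exact: num_real.
by move=> z zM x _; apply: le_trans (ltW zM).
Qed.

(** The one-variable result is applied twice: in [x] to the partial averages of [f] over [y], then
    in [y] for almost every [x]. The first step is run for countably many centers and scales, so its
    null sets have a null union. *)
Lemma ae_le_of_tensor_kernel_le (f : R * R -> R) e1 e2 (I J : set R) (M r : R) :
  e1 * e1 = 1 -> e2 * e2 = 1 -> 0 < r -> open I -> open J ->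
  leb2.-integrable setT (EFin \o f) ->
  (forall x y s t, I x -> J y -> 0 < s <= r -> 0 < t <= r ->
    `|\int[leb2]_z (f z * (kernel2 e1 x s z.1 * kernel2 e2 y t z.2))| <= M) ->
  {ae leb2, forall z, I z.1 -> J z.2 -> `|f z| <= M}.
Proof.
move=> e11 e21 r0 oI oJ If H.
have mulrCB (a b c : R) : a * b * c = a * (c * b) by rewrite -mulrA (mulrC b).
have [B1 _] := @ramp_boundP R.
pose G (q : rat) n (x : R) :=
  \int[mu]_y (f (x, y) * kernel2 e2 (ratr q) n.+1%:R^-1 y).
have s0 n : 0 < n.+1%:R^-1 :> R by rewrite invr_gt0.
have Ifk (q : rat) n : leb2.-integrable setT
    (EFin \o (fun z => f z * kernel2 e2 (ratr q) n.+1%:R^-1 z.2)).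
  apply: (integrableM_bounded If (measurable_kernel2_snd _ _ _)) => z.
  exact: kernel2_le.
have HG (q : rat) n : J (ratr q) -> n.+1%:R^-1 <= r ->
    {ae mu, forall x, I x -> `|G q n x| <= M}.
  move=> Jq nr; apply: (ae_le_of_kernel_le e11 r0 oI).
    exact: (integrable_slice (Ifk q n)).
  move=> p k Ip kr.
  have := @Rintegral_slice _ _ _ _ _ mu mu _ _
    (@measurable_kernel2 R e1 (ratr p) k.+1%:R^-1) (Ifk q n).
  move=> ->; last first.
    apply: (integrableM_bounded (Ifk q n) (measurable_kernel2_fst _ _ _)) => z.
    exact: kernel2_le.
  have -> : \int[(mu \x mu)%E]_z (f z * kernel2 e2 (ratr q) n.+1%:R^-1 z.2 *
      kernel2 e1 (ratr p) k.+1%:R^-1 z.1) = \int[leb2]_z (f z *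
      (kernel2 e1 (ratr p) k.+1%:R^-1 z.1 * kernel2 e2 (ratr q) n.+1%:R^-1 z.2)).
    rewrite /leb2; apply: eq_Rintegral => z _.
    exact: mulrCB.
  by apply: H => //; rewrite s0.
have HGall : {ae mu, forall x, forall n q, J (ratr q) -> n.+1%:R^-1 <= r ->
    I x -> `|G q n x| <= M}.
  apply: ae_foralln => n.
  (* The countable intersection is indexed by naturals, so rational centers are enumerated by their
     codes; a number coding no rational imposes nothing. *)
  have : {ae mu, forall x, forall k, if (unpickle k : option rat) is Some q then
      J (ratr q) -> n.+1%:R^-1 <= r -> I x -> `|G q n x| <= M else True}.
    apply: ae_foralln => k; case: unpickle => [q|]; last exact: aeW.
    have [[Jq nr]|np] := pselect (J (ratr q) /\ n.+1%:R^-1 <= r :> R).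
      apply: (@filterS _ _ (ae_filter_ringOfSetsType mu) _ _ _ (HG q n Jq nr)).
      by move=> x Hx _ _.
    by apply: aeW => x Jq nr; case: np.
  apply: (@filterS _ _ (ae_filter_ringOfSetsType mu)) => x Hx q.
  by have := Hx (pickle q); rewrite pickleK.
have Hae : {ae mu, forall x, {ae mu, forall y, I x -> J y -> `|f (x, y)| <= M}}.
  have := ae_integrable1 If.
  apply: (@filterS2 _ _ (ae_filter_ringOfSetsType mu) _ _ _ _ HGall) => x Hx Ix.
  have [xI|xI] := pselect (I x); last by apply: aeW => y.
  have := @ae_le_of_kernel_le R (fun y => f (x, y)) e2 M r J e21 r0 oJ Ix.
  have Hq : forall (q : rat) (n : nat), J (ratr q) -> n.+1%:R^-1 <= r ->
      `|\int[mu]_y (f (x, y) * kernel2 e2 (ratr q) n.+1%:R^-1 y)| <= M.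
    by move=> q n Jq nr; exact: (Hx n q Jq nr xI).
  move=> /(_ Hq); apply: (@filterS _ _ (ae_filter_ringOfSetsType mu)).
  by move=> y Hy _.
(* The exceptional set is measurable, as required to compute its product measure slice by slice. *)
pose A : set (T * T) := (I `*` J) `&` [set z | M < `|f z|].
have mf : measurable_fun (setT : set (T * T)) f.
  by apply/measurable_EFinP; case/integrableP: If.
have mA : measurable A.
  apply: measurableI.
    by apply: measurableX; exact: open_measurable.
  rewrite (_ : [set z | _] = (fun z => `|f z|) @^-1` `]M, +oo[); last first.
    by apply/seteqP; split => z /=; rewrite in_itv/= andbT.
  rewrite -[X in measurable X]setTI.
  by apply: (measurableT_comp (@normr_measurable _ _) mf).
exists A; split => //.
  apply: (negligible_slices mA).
  apply: (@filterS _ _ (ae_filter_ringOfSetsType mu) _ _ _ Hae) => x.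
  apply: (@filterS _ _ (ae_filter_ringOfSetsType mu)) => y Hxy [[/= Ix Jy]].
  by rewrite ltNge Hxy.
move=> z /= /not_implyP[Iz /not_implyP[Jz /negP]]; rewrite -ltNge => zM.
by split.
Qed.

End plane_kernel.

(** * Estimates on the kernel averages *)

Section cauchy_schwarz.
Context d (U : measurableType d) (R : realType).
Variable m : {measure set U -> \bar R}.
Implicit Types (f k : U -> R) (S D : set U) (B v : R).

(** The measure of [S] is given as a square so that the bound [B * v] is free of roots. *)
Lemma L2norm_bounded_supp k S B v : measurable_fun setT k -> measurable S ->
  0 <= B -> 0 <= v -> m S = (v ^+ 2)%:E -> (forall x, `|k x| <= B) ->
  (forall x, ~ S x -> k x = 0) -> ('N[m]_2%:E[EFin \o k] <= (B * v)%:E)%E.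
Proof.
move=> mk mS B0 v0 mSv kB k0; rewrite unlock.
have Bv0 : 0 <= B * v by rewrite mulr_ge0.
have -> : (B * v)%:E = (((B * v) ^+ 2)%:E `^ 2^-1)%E.
  by rewrite poweR_EFin -powR_mulrn// -powRrM mulfV// powRr1.
have -> : (\int[m]_x (`|(EFin \o k) x| `^ 2) = \int[m]_x (k x ^+ 2)%:E)%E.
  by apply: eq_integral => x _; rewrite /= powR_mulrn// real_normK ?num_real.
apply: gt0_ler_poweR => //; rewrite ?in_itv/= ?leey ?andbT.
- by apply: integral_ge0 => x _; rewrite lee_fin sqr_ge0.
- by rewrite lee_fin exprn_ge0.
apply: (@le_trans _ _ (\int[m]_x (B ^+ 2 * \1_S x)%:E)%E).
  apply: ge0_le_integral => //.
  - by move=> x _; rewrite lee_fin sqr_ge0.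
  - by apply/measurable_EFinP; exact: measurable_funX.
  - by apply/measurable_EFinP; apply: measurable_funM.
  - move=> x _; rewrite lee_fin indicE -real_normK ?num_real//.
    have [xS|xS] := pselect (S x).
      by rewrite mem_set// mulr1 lerXn2r// nnegrE.
    by rewrite k0// memNset// mulr0 normr0 expr0n.
under eq_integral do rewrite EFinM.
rewrite ge0_integralZl//; last by rewrite lee_fin exprn_ge0.
  by rewrite integral_indic// setIT mSv -EFinM exprMn.
exact/measurable_EFinP.
Qed.

Lemma Lfun_bounded_supp k S B v : measurable_fun setT k -> measurable S ->
  0 <= B -> 0 <= v -> m S = (v ^+ 2)%:E -> (forall x, `|k x| <= B) ->
  (forall x, ~ S x -> k x = 0) -> k \in Lfun m 2%:E.
Proof.
move=> mk mS B0 v0 mSv kB k0; rewrite inE; apply/andP; split; rewrite inE//=.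
apply: le_lt_trans (ltry (B * v)).
exact: (@L2norm_bounded_supp k S).
Qed.

Lemma L2_fin_num D f : L2 m D f -> L2norm m D f \is a fin_num.
Proof.
rewrite /L2 /L2norm inE => /andP[_]; rewrite inE /= /finite_norm.
by rewrite ge0_fin_numE// Lnorm_ge0.
Qed.

Lemma restrictM D f k : ((fun x => f x * k x) \_ D) = (fun x => (f \_ D) x * k x).
Proof.
by apply/funext => x; rewrite !patchE; case: ifP; rewrite ?mul0r.
Qed.

Lemma L2_mul_integrable D f k : L2 m D f -> k \in Lfun m 2%:E ->
  m.-integrable setT (EFin \o (fun x => (f \_ D) x * k x)).
Proof.
move=> Lf Lk; have := Lfun2_mul_Lfun1 Lf Lk.
by move=> /Lfun1_integrable.
Qed.

Lemma cauchy_schwarz D f k S B v : L2 m D f ->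
  measurable_fun setT k -> measurable S ->
  0 <= B -> 0 <= v -> m S = (v ^+ 2)%:E -> (forall x, `|k x| <= B) ->
  (forall x, ~ S x -> k x = 0) ->
  `|\int[m]_(x in D) (f x * k x)| <= fine (L2norm m D f) * (B * v).
Proof.
move=> Lf mk mS B0 v0 mSv kB k0.
have Lk : k \in Lfun m 2%:E by exact: (@Lfun_bounded_supp k S B v).
have Ifk := L2_mul_integrable Lf Lk.
rewrite Rintegral_mkcond restrictM -lee_fin EFin_normr_Rintegral//.
apply: le_trans (le_abse_integral _ _ _) _ => //.
  by case/integrableP: Ifk.
have mf : measurable_fun setT (f \_ D).
  by move: Lf; rewrite /L2 inE => /andP[]; rewrite inE.
have := @hoelder _ _ _ m _ _ 2 2 mf mk (ltr0Sn R 1) (ltr0Sn R 1).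
have -> : 2^-1 + 2^-1 = 1 :> R by lra.
move=> /(_ erefl); rewrite Lnorm1 => H; apply: le_trans H _.
rewrite EFinM fineK ?L2_fin_num//; apply: lee_wpmul2l; first exact: Lnorm_ge0.
exact: (@L2norm_bounded_supp k S).
Qed.

End cauchy_schwarz.

(** * The local estimate at the corner of a square *)

Section estimate.
Context {R : realType}.
Implicit Types (a b : R -> R) (f g : R * R -> R) (e c r s t : R).
Notation T := (measurableTypeR R).

Definition supported e c r a := forall x, ~~ in_seg e c r x -> a x = 0.

(** It contains the support for all four choices of directions, at the cost of a side [2 * r]
    instead of [r]. *)
Definition square (x y r : R) : set (T * T) :=
  `[x - r, x + r]%classic `*` `[y - r, y + r]%classic.

Lemma measurable_square x y r : measurable (square x y r).
Proof. by apply: measurableX; exact: measurable_itv. Qed.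

Lemma leb2_rectangle (x1 x2 y1 y2 : R) (b1 b2 b3 b4 : bool) : x1 <= x2 -> y1 <= y2 ->
  leb2 ([set` Interval (BSide b1 x1) (BSide b2 x2)] `*`
        [set` Interval (BSide b3 y1) (BSide b4 y2)]) =
  ((x2 - x1) * (y2 - y1))%:E.
Proof.
move=> x12 y12.
transitivity (lebesgue_measure [set` Interval (BSide b1 x1) (BSide b2 x2)] *
              lebesgue_measure [set` Interval (BSide b3 y1) (BSide b4 y2)])%E.
  by apply: product_measure1E; exact: measurable_itv.
rewrite !lebesgue_measure_itv /=.
have H (u v : R) : u <= v -> (if (u%:E < v%:E)%E then v%:E - u%:E else 0)%E = (v - u)%:E.
  rewrite le_eqVlt => /orP[/eqP ->|uv]; first by rewrite ltxx subrr.
  by rewrite lte_fin uv.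
by rewrite EFinM -!H.
Qed.

Lemma leb2_square x y r : 0 <= r -> leb2 (square x y r) = ((2 * r) ^+ 2)%:E.
Proof.
move=> r0; rewrite leb2_rectangle; [|lra..].
by congr (_%:E); ring.
Qed.

Lemma measurable_tensor a b : continuous a -> continuous b ->
  measurable_fun (setT : set (T * T)) (tensor a b).
Proof.
move=> ca cb; apply: (measurable_funM (f := fun z : T * T => a z.1) (g := fun z : T * T => b z.2)).
  exact: (measurableT_comp (f := (a : T -> R)) (continuous_measurable_fun ca) measurable_fst).
exact: (measurableT_comp (f := (b : T -> R)) (continuous_measurable_fun cb) measurable_snd).
Qed.

Lemma tensor_supp a b e1 e2 x y r z : e1 * e1 = 1 -> e2 * e2 = 1 ->
  supported e1 x r a -> supported e2 y r b ->
  ~ square x y r z -> tensor a b z = 0.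
Proof.
move=> e11 e21 sa sb nz; rewrite /tensor.
have [z1|/sa ->] := boolP (in_seg e1 x r z.1); last by rewrite mul0r.
have [z2|/sb ->] := boolP (in_seg e2 y r z.2); last by rewrite mulr0.
case: nz; have := in_segP e11 z1; have := in_segP e21 z2.
rewrite !ler_norml => /andP[? ?] /andP[? ?].
by split; rewrite /= in_itv/=; apply/andP; split; lra.
Qed.

Lemma tensor_le a b A B z : (forall x, `|a x| <= A) -> (forall x, `|b x| <= B) ->
  `|tensor a b z| <= A * B.
Proof. by move=> aA bB; rewrite /tensor normrM ler_pM. Qed.

Section domain.
Variables (Om : set (R * R)) (e1 e2 x y r : R).
Hypotheses (e11 : e1 * e1 = 1) (e21 : e2 * e2 = 1) (r0 : 0 < r).
Hypothesis mOm : measurable (Om : set (T * T)).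
Hypothesis subOm : forall z, in_seg e1 x r z.1 -> in_seg e2 y r z.2 -> Om z.

(** The coefficients [(1 - e) / 2] and [(1 + e) / 2] are 0 or 1 according to the sign of [e], which
    treats both directions at once. *)
Definition seg_lo e c : R := c - (1 - e) / 2 * r.
Definition seg_hi e c : R := c + (1 + e) / 2 * r.

Lemma in_seg_itv e c u : e * e = 1 ->
  (u \in `[seg_lo e c, seg_hi e c]) = in_seg e c r u.
Proof.
rewrite in_itv /= /seg_lo /seg_hi /in_seg => /sq1_cases[] ->.
  rewrite subrr !mul0r subr0 mul1r subr_ge0 (_ : (1 + 1) / 2 = 1); last lra.
  by rewrite mul1r lerBlDl.
rewrite opprK addrN !mul0r addr0 (_ : (1 + 1) / 2 = 1); last lra.
rewrite mul1r mulN1r opprB subr_ge0 andbC; congr (_ && _).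
by rewrite lerBlDr lerBlDl.
Qed.

Lemma test_tensor_seg a b : smooth_line a -> smooth_line b ->
  supported e1 x r a -> supported e2 y r b -> test_function Om (tensor a b).
Proof.
move=> sa sb pa pb.
apply: (@test_tensor _ _ _ _ (seg_lo e1 x) (seg_hi e1 x) (seg_lo e2 y) (seg_hi e2 y)) => //.
- by move=> u; rewrite in_seg_itv//; exact: pa.
- by move=> u; rewrite in_seg_itv//; exact: pb.
- move=> z [/= z1 z2]; apply: subOm.
    by rewrite -in_seg_itv.
  by rewrite -in_seg_itv.
Qed.

Lemma tensor_integral_le g a b A B : L2 leb2 Om g ->
  smooth_line a -> smooth_line b -> supported e1 x r a -> supported e2 y r b ->
  (forall u, `|a u| <= A) -> (forall u, `|b u| <= B) ->
  `|\int[leb2]_(z in Om) (g z * tensor a b z)| <=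
    fine (L2norm leb2 Om g) * (A * B * (2 * r)).
Proof.
move=> Lg sa sb pa pb aA bB.
have A0 : 0 <= A by apply: le_trans (aA 0).
have B0 : 0 <= B by apply: le_trans (bB 0).
apply: (cauchy_schwarz (m := leb2) (S := square x y r)) => //.
- by apply: measurable_tensor; exact: smooth_line_continuous.
- exact: measurable_square.
- by rewrite mulr_ge0.
- by rewrite mulr_ge0// ltW.
- by apply: leb2_square; exact: ltW.
- by move=> z; exact: tensor_le.
- by move=> z; exact: (tensor_supp e11 e21 pa pb).
Qed.

Lemma tensor_integrable g a b A B : L2 leb2 Om g ->
  smooth_line a -> smooth_line b -> supported e1 x r a -> supported e2 y r b ->
  (forall u, `|a u| <= A) -> (forall u, `|b u| <= B) ->
  leb2.-integrable Om (EFin \o (fun z => g z * tensor a b z)).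
Proof.
move=> Lg sa sb pa pb aA bB.
have A0 : 0 <= A by apply: le_trans (aA 0).
have B0 : 0 <= B by apply: le_trans (bB 0).
apply/integrable_mkcond => //.
rewrite restrict_EFin restrictM; apply: L2_mul_integrable => //.
apply: (@Lfun_bounded_supp _ _ _ leb2 (tensor a b) (square x y r) (A * B) (2 * r)).
- by apply: measurable_tensor; exact: smooth_line_continuous.
- exact: measurable_square.
- by rewrite mulr_ge0.
- by rewrite mulr_ge0// ltW.
- by apply: leb2_square; exact: ltW.
- by move=> z; exact: tensor_le.
- by move=> z; exact: (tensor_supp e11 e21 pa pb).
Qed.

(** One integration by parts: a derivative leaves the factor in direction [i] and falls on [f]. Both
    factors are supported in segments whose product lies in [Om], so the tensor is an admissible
    test function. *)
Lemma weak_tensor (i : 'I_2) f g a b a' b' : weak_partial Om i f g ->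
  smooth_line a -> smooth_line b -> supported e1 x r a -> supported e2 y r b ->
  (forall u, is_derive u (1 : R) a (a' u)) ->
  (forall u, is_derive u (1 : R) b (b' u)) ->
  \int[leb2]_(z in Om) (f z * (if i == ord0 then tensor a' b else tensor a b') z) =
  - \int[leb2]_(z in Om) (g z * tensor a b z).
Proof.
move=> [_ W] sa sb pa pb da db.
rewrite -(W _ (test_tensor_seg sa sb pa pb)).
apply: eq_Rintegral => z _.
by rewrite (@derive_val _ _ _ _ _ _ _ (derive_tensor i da db z)).
Qed.

Lemma supported_kernel2 e c s : 0 < s <= r -> supported e c r (kernel2 e c s).
Proof.
move=> /andP[s0 sr] u nu; apply: kernel2_supp => //.
by apply: contra nu; exact: in_segS.
Qed.

(** After integration by parts, each of the four terms pairs [f] or a second derivative with a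
    tensor bounded uniformly in [s] and [t], on an area of order [r ^ 2]. The height is of order
    [r ^ -2] for the coarse term and of order 1 for the others, which gives [|f| / r] and
    [r |D^2 f|]. *)
Lemma local_estimate f g0 g1 g00 g01 g11 s t :
  L2 leb2 Om f ->
  weak_partial Om ord0 f g0 -> weak_partial Om ord_max f g1 ->
  weak_partial Om ord0 g0 g00 -> weak_partial Om ord_max g0 g01 ->
  weak_partial Om ord_max g1 g11 ->
  0 < s <= r -> 0 < t <= r ->
  `|\int[leb2]_(z in Om) (f z * (kernel2 e1 x s z.1 * kernel2 e2 y t z.2))| <=
  16 * ramp_bound ^+ 2 * (fine (L2norm leb2 Om f) / r +
    r * (fine (L2norm leb2 Om g00) + fine (L2norm leb2 Om g01) +
         fine (L2norm leb2 Om g11))).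
Proof.
move=> Lf W0 W1 W00 W01 W11 sr tr.
have rr : 0 < r <= r by rewrite r0 lexx.
have /andP[s0 sler] := sr; have /andP[t0 tler] := tr.
have [B1 _] := @ramp_boundP R.
have B0 : 0 <= @ramp_bound R by lra.
pose K := kernel2 e1 x r; pose K' := kernel2 e2 y r.
pose Z := dkernel1 e1 x s r; pose Z' := dkernel1 e2 y t r.
pose Q := dkernel0 e1 x s r; pose Q' := dkernel0 e2 y t r.
pose D u := kernel2 e1 x s u - kernel2 e1 x r u.
pose D' u := kernel2 e2 y t u - kernel2 e2 y r u.
have dQ u : is_derive u (1 : R) Q (Z u) by apply: is_derive_dkernel0; rewrite gt_eqF.
have dQ' u : is_derive u (1 : R) Q' (Z' u) by apply: is_derive_dkernel0; rewrite gt_eqF.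
have dZ u : is_derive u (1 : R) Z (D u) by exact: is_derive_dkernel1.
have dZ' u : is_derive u (1 : R) Z' (D' u) by exact: is_derive_dkernel1.
have sK : smooth_line K by exact: smooth_kernel2.
have sK' : smooth_line K' by exact: smooth_kernel2.
have sQ : smooth_line Q by exact: smooth_dkernel0.
have sQ' : smooth_line Q' by exact: smooth_dkernel0.
have sZ : smooth_line Z by exact: smooth_dkernel1.
have sZ' : smooth_line Z' by exact: smooth_dkernel1.
have sD : smooth_line D by exact: smooth_line_derive dZ sZ.
have sD' : smooth_line D' by exact: smooth_line_derive dZ' sZ'.
have dK := is_derive_derive1 sK; have dK' := is_derive_derive1 sK'.
have dD' := is_derive_derive1 sD'.
have pK : supported e1 x r K by exact: supported_kernel2.
have pK' : supported e2 y r K' by exact: supported_kernel2.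
have pQ : supported e1 x r Q by move=> u; exact: dkernel0_supp.
have pQ' : supported e2 y r Q' by move=> u; exact: dkernel0_supp.
have pZ : supported e1 x r Z by move=> u; exact: dkernel1_supp.
have pZ' : supported e2 y r Z' by move=> u; exact: dkernel1_supp.
have pD : supported e1 x r D.
  by move=> u nu; rewrite /D !supported_kernel2// subrr.
have pD' : supported e2 y r D'.
  by move=> u nu; rewrite /D' !supported_kernel2// subrr.
have bK u : `|K u| <= ramp_bound / r by exact: kernel2_le.
have bK' u : `|K' u| <= ramp_bound / r by exact: kernel2_le.
have bQ u : `|Q u| <= 2 * r by exact: dkernel0_le.
have bQ' u : `|Q' u| <= 2 * r by exact: dkernel0_le.
have bZ u : `|Z u| <= 2 * ramp_bound by exact: dkernel1_le.
have bZ' u : `|Z' u| <= 2 * ramp_bound by exact: dkernel1_le.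
(* These bounds explode as [s] or [t] tends to 0; they serve the integrability of the terms and do
   not enter the final constant. *)
have bD u : `|D u| <= ramp_bound / s + ramp_bound / r.
  by apply: le_trans (ler_normB _ _) _; apply: lerD; exact: kernel2_le.
have bD' u : `|D' u| <= ramp_bound / t + ramp_bound / r.
  by apply: le_trans (ler_normB _ _) _; apply: lerD; exact: kernel2_le.
have IKK := tensor_integrable Lf sK sK' pK pK' bK bK'.
have IDK := tensor_integrable Lf sD sK' pD pK' bD bK'.
have IKD := tensor_integrable Lf sK sD' pK pD' bK bD'.
have IDD := tensor_integrable Lf sD sD' pD pD' bD bD'.
have -> : \int[leb2]_(z in Om) (f z * (kernel2 e1 x s z.1 * kernel2 e2 y t z.2)) =
    \int[leb2]_(z in Om) (f z * tensor K K' z) +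
    \int[leb2]_(z in Om) (f z * tensor D K' z) +
    (\int[leb2]_(z in Om) (f z * tensor K D' z) +
     \int[leb2]_(z in Om) (f z * tensor D D' z)).
  rewrite -!RintegralD//; last 2 first.
  - exact: (integrableD mOm IKK IDK).
  - exact: (integrableD mOm IKD IDD).
  have H (k k' l l' v : R) : v * (k * l) =
    v * (k' * l') + v * ((k - k') * l') + (v * (k' * (l - l')) + v * ((k - k') * (l - l'))).
    by ring.
  by apply: eq_Rintegral => z _; exact: H.
(* Two integrations by parts in the first variable replace [D] by [Q], of which it is the second
   derivative. *)
have W_DK : \int[leb2]_(z in Om) (f z * tensor D K' z) =
    \int[leb2]_(z in Om) (g00 z * tensor Q K' z).
  have := weak_tensor W0 sZ sK' pZ pK' dZ dK'; rewrite eqxx => ->.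
  have := weak_tensor W00 sQ sK' pQ pK' dQ dK'; rewrite eqxx => ->.
  by rewrite opprK.
have W_KD : \int[leb2]_(z in Om) (f z * tensor K D' z) =
    \int[leb2]_(z in Om) (g11 z * tensor K Q' z).
  have := weak_tensor W1 sK sZ' pK pZ' dK dZ' => /= ->.
  have := weak_tensor W11 sK sQ' pK pQ' dK dQ' => /= ->.
  by rewrite opprK.
(* One integration by parts in each variable: the mixed derivative of [f] meets [Z] and [Z'],
   bounded uniformly in the scales. *)
have W_DD : \int[leb2]_(z in Om) (f z * tensor D D' z) =
    \int[leb2]_(z in Om) (g01 z * tensor Z Z' z).
  have := weak_tensor W0 sZ sD' pZ pD' dZ dD'; rewrite eqxx => ->.
  have := weak_tensor W01 sZ sZ' pZ pZ' dZ dZ' => /= ->.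
  by rewrite opprK.
rewrite W_DK W_KD W_DD.
have E1 := tensor_integral_le Lf sK sK' pK pK' bK bK'.
have E2 := tensor_integral_le W00.1 sQ sK' pQ pK' bQ bK'.
have E3 := tensor_integral_le W11.1 sK sQ' pK pQ' bK bQ'.
have E4 := tensor_integral_le W01.1 sZ sZ' pZ pZ' bZ bZ'.
have n0 h : 0 <= fine (L2norm leb2 Om h) by rewrite fine_ge0// Lnorm_ge0.
apply: le_trans (ler_normD _ _) _.
apply: le_trans (lerD (ler_normD _ _) (ler_normD _ _)) _.
apply: le_trans (lerD (lerD E1 E2) (lerD E3 E4)) _.
have Hf := n0 f; have Hxx := n0 g00; have Hyy := n0 g11; have Hxy := n0 g01.
set nf := fine (L2norm leb2 Om f) in Hf *.
set nxx := fine (L2norm leb2 Om g00) in Hxx *.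
set nyy := fine (L2norm leb2 Om g11) in Hyy *.
set nxy := fine (L2norm leb2 Om g01) in Hxy *.
have -> : nf * (ramp_bound / r * (ramp_bound / r) * (2 * r)) = 2 * ramp_bound ^+ 2 * (nf / r).
  by field; rewrite gt_eqF.
have -> : nxx * (2 * r * (ramp_bound / r) * (2 * r)) = 4 * ramp_bound * (r * nxx).
  by field; rewrite gt_eqF.
have -> : nyy * (ramp_bound / r * (2 * r) * (2 * r)) = 4 * ramp_bound * (r * nyy).
  by field; rewrite gt_eqF.
have -> : nxy * (2 * ramp_bound * (2 * ramp_bound) * (2 * r)) = 8 * ramp_bound ^+ 2 * (r * nxy).
  by ring.
(* With [B = ramp_bound] at least 1, the coefficients [2 B ^ 2], [4 B], [4 B] and [8 B ^ 2] are all
   at most [16 B ^ 2]. *)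
have B2 : @ramp_bound R <= ramp_bound ^+ 2 by rewrite expr2 ler_peMl.
have P1 : 0 <= nf / r by rewrite divr_ge0// ltW.
have P2 : 0 <= r * nxx by rewrite mulr_ge0// ltW.
have P3 : 0 <= r * nyy by rewrite mulr_ge0// ltW.
have P4 : 0 <= r * nxy by rewrite mulr_ge0// ltW.
rewrite !mulrDr; move: (nf / r) (r * nxx) (r * nyy) (r * nxy) P1 P2 P3 P4.
move=> p1 p2 p3 p4 P1 P2 P3 P4.
have := ler_wpM2r P2 B2; have := ler_wpM2r P3 B2.
have := mulr_ge0 (sqr_ge0 (@ramp_bound R)) P1; have := mulr_ge0 (sqr_ge0 (@ramp_bound R)) P2.
have := mulr_ge0 (sqr_ge0 (@ramp_bound R)) P3; have := mulr_ge0 (sqr_ge0 (@ramp_bound R)) P4.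
rewrite -!mulrA; lra.
Qed.

End domain.

End estimate.

(** * Almost everywhere bound on the rectangle *)

Section strip.
Context {R : realType}.
Implicit Types (f g : R * R -> R) (L r : R) (u : 'I_2 -> R * R -> R).
Notation T := (measurableTypeR R).

Lemma wD_weak_partial (Om : set (R * R)) i f :
  (exists g, weak_partial Om i f g) -> weak_partial Om i f (wD Om i f).
Proof. exact: xgetPex. Qed.

Lemma measurable_Omega L : measurable (Omega L : set (T * T)).
Proof. by apply: measurableX; exact: measurable_itv. Qed.

Lemma leb2_Omega L : 0 <= L -> leb2 (Omega L) = (2 * L)%:E.
Proof.
move=> L0; rewrite leb2_rectangle; [|lra..].
by congr (_%:E); ring.
Qed.

(** The rectangle has finite area, so multiplying by its indicator, itself in L2, takes L2 into
    L1. *)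
Lemma L2_Omega_integrable L f : 0 <= L -> L2 leb2 (Omega L) f ->
  leb2.-integrable setT (EFin \o (f \_ (Omega L))).
Proof.
move=> L0 Lf.
have -> : f \_ (Omega L) = (fun z => (f \_ (Omega L)) z * \1_(Omega L) z).
  apply/funext => z; rewrite indicE patchE; case: ifPn => _; first by rewrite mulr1.
  by rewrite mul0r.
apply: L2_mul_integrable Lf _.
apply: (@Lfun_bounded_supp _ _ _ leb2 _ (Omega L) 1 (Num.sqrt (2 * L))) => //.
- by apply: measurable_indic; exact: measurable_Omega.
- exact: measurable_Omega.
- by rewrite sqr_sqrtr ?leb2_Omega// mulr_ge0.
- by move=> z; rewrite indicE; case: (z \in _); rewrite /= ?normr1 ?normr0.
- by move=> z nz; rewrite indicE memNset.
Qed.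

(* The points of [`]a, b[] from which the segment of length [r] in the direction
   [e = 1] or [e = -1] stays inside [`]a, b[]. *)
Definition inner (a b e r : R) : set R := `]a + (1 - e) / 2 * r, b - (1 + e) / 2 * r[%classic.

Lemma inner_seg a b e r c v : e * e = 1 -> 0 < r ->
  inner a b e r c -> in_seg e c r v -> a < v < b.
Proof.
rewrite /inner /in_seg /= in_itv /= => /sq1_cases[] -> r0 /andP[? ?] /andP[? ?].
  by apply/andP; split; lra.
by apply/andP; split; lra.
Qed.

(** A point cannot lie within [r] of both ends. *)
Lemma inner_cover a b r c : 2 * r < b - a -> a < c < b ->
  inner a b 1 r c \/ inner a b (-1) r c.
Proof.
move=> rab /andP[ac cb]; rewrite /inner /= !in_itv /=.
have [H|H] := ltP c (b - r); [left|right]; apply/andP; split; lra.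
Qed.

(** The right-hand side of [local_estimate]; [L] enters through the norms alone. *)
Definition agmon_bound L f r : R := 16 * ramp_bound ^+ 2 *
  (fine (L2norm leb2 (Omega L) f) / r +
    r * (fine (L2norm leb2 (Omega L) (wD (Omega L) ord0 (wD (Omega L) ord0 f))) +
         fine (L2norm leb2 (Omega L) (wD (Omega L) ord_max (wD (Omega L) ord0 f))) +
         fine (L2norm leb2 (Omega L) (wD (Omega L) ord_max (wD (Omega L) ord_max f))))).

(** Segments starting at inner points stay in the rectangle, so the local estimate holds there for
    all scales up to [r]; the limit is then taken for [f] extended by zero. *)
Lemma ae_le_agmon_bound_inner L f r e1 e2 : 1 <= L -> 0 < r ->
  e1 * e1 = 1 -> e2 * e2 = 1 -> sobolev2 (Omega L) f ->
  {ae leb2, forall z, inner (- L) L e1 r z.1 -> inner 0 1 e2 r z.2 ->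
    `|(f \_ (Omega L)) z| <= agmon_bound L f r}.
Proof.
move=> L1 r0 e11 e21 [[Lf Wf] Wff].
have L0 : 0 <= L by lra.
apply: (ae_le_of_tensor_kernel_le e11 e21 r0).
- exact: interval_open.
- exact: interval_open.
- exact: L2_Omega_integrable.
move=> x y s t Ix Jy sr tr.
rewrite -restrictM -Rintegral_mkcond.
have sub z : in_seg e1 x r z.1 -> in_seg e2 y r z.2 -> Omega L z.
  move=> z1 z2; have := inner_seg e11 r0 Ix z1; have := inner_seg e21 r0 Jy z2.
  by move=> ? ?; split; rewrite /= in_itv.
have W0 := wD_weak_partial (Wf ord0); have W1 := wD_weak_partial (Wf ord_max).
have W00 := wD_weak_partial ((Wff ord0).2 ord0).
have W01 := wD_weak_partial ((Wff ord0).2 ord_max).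
have W11 := wD_weak_partial ((Wff ord_max).2 ord_max).
exact: (local_estimate e11 e21 r0 (measurable_Omega L) sub Lf W0 W1 W00 W01 W11 sr tr).
Qed.

(** The four pairs of directions together cover the rectangle. Its sides have length at least 1, so
    the same range of [r] serves every [L]. *)
Lemma ae_le_agmon_bound L f r : 1 <= L -> 0 < r <= 4^-1 -> sobolev2 (Omega L) f ->
  {ae leb2, forall z, Omega L z -> `|f z| <= agmon_bound L f r}.
Proof.
move=> L1 /andP[r0 r4] Hf.
have e1 : 1 * 1 = 1 :> R by rewrite mulr1.
have eN : -1 * -1 = 1 :> R by rewrite mulrNN mulr1.
have F := ae_filter_ringOfSetsType (@leb2 R).
have H1 := ae_le_agmon_bound_inner L1 r0 e1 e1 Hf.
have H2 := ae_le_agmon_bound_inner L1 r0 e1 eN Hf.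
have H3 := ae_le_agmon_bound_inner L1 r0 eN e1 Hf.
have H4 := ae_le_agmon_bound_inner L1 r0 eN eN Hf.
have H12 := @filterI _ _ F _ _ H1 H2; have H34 := @filterI _ _ F _ _ H3 H4.
apply: (@filterS _ _ F _ _ _ (@filterI _ _ F _ _ H12 H34)) => z [[h1 h2] [h3 h4]] Oz.
have fz : (f \_ (Omega L)) z = f z by rewrite patchE mem_set.
rewrite /= fz in h1 h2 h3 h4.
have [/= z1 z2] := Oz; rewrite in_itv /= in z1; rewrite in_itv /= in z2.
have c1 : 2 * r < L - - L by lra.
have c2 : 2 * r < 1 - 0 by lra.
by case: (inner_cover c1 z1) => I1; case: (inner_cover c2 z2) => I2;
  [exact: h1|exact: h2|exact: h3|exact: h4].
Qed.

End strip.

(** * Sobolev norms *)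

Section norms.
Context {R : realType}.
Implicit Types (f g : R * R -> R) (L r : R) (u : 'I_2 -> R * R -> R).
Notation T := (measurableTypeR R).

Lemma L2norm_sq (Om : set (R * R)) f : L2 leb2 Om f ->
  (L2norm leb2 Om f `^ 2 = (fine (L2norm leb2 Om f) ^+ 2)%:E)%E.
Proof.
move=> Lf; rewrite -{1}(fineK (L2_fin_num Lf)) poweR_EFin powR_mulrn//.
by rewrite fine_ge0// Lnorm_ge0.
Qed.

Lemma L2norm_sqE (Om : set (R * R)) f :
  (L2norm leb2 Om f `^ 2 = \int[leb2]_z ((f \_ Om) z ^+ 2)%:E)%E.
Proof.
rewrite /L2norm powR_Lnorm//; apply: eq_integral => z _.
by rewrite /= powR_mulrn// real_normK ?num_real.
Qed.

Lemma poweR_sqrK (x : \bar R) (v : R) : (0 <= x)%E -> (x `^ 2 = (v ^+ 2)%:E)%E ->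
  0 <= v -> x = v%:E.
Proof.
move=> x0 xv v0; have : ((x `^ 2) `^ 2^-1 = (v ^+ 2)%:E `^ 2^-1)%E by rewrite xv.
rewrite -poweRrM mulfV// poweRe1// poweR_EFin -powR_mulrn// -powRrM mulfV//.
by rewrite powRr1.
Qed.

Lemma vnorm_sq u z : vnorm u z ^+ 2 = u ord0 z ^+ 2 + u ord_max z ^+ 2.
Proof.
rewrite /vnorm sqr_sqrtr; last by apply: sumr_ge0 => i _; exact: sqr_ge0.
rewrite !big_ord_recl big_ord0 addr0; congr (_ + u _ z ^+ 2).
exact: val_inj.
Qed.

Lemma L2norm_vnorm (Om : set (R * R)) u : (forall i, L2 leb2 Om (u i)) ->
  L2norm leb2 Om (vnorm u) =
  (Num.sqrt (fine (L2norm leb2 Om (u ord0)) ^+ 2 +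
             fine (L2norm leb2 Om (u ord_max)) ^+ 2))%:E.
Proof.
move=> Lu; apply: poweR_sqrK; rewrite ?Lnorm_ge0 ?sqrtr_ge0//.
rewrite sqr_sqrtr ?addr_ge0 ?sqr_ge0// EFinD -!L2norm_sq// !L2norm_sqE.
have mu_ i : measurable_fun (setT : set (T * T)) (u i \_ Om).
  by move: (Lu i); rewrite /L2 inE => /andP[]; rewrite inE.
rewrite -ge0_integralD//; last 4 first.
- by move=> z _; rewrite lee_fin sqr_ge0.
- by apply/measurable_EFinP; exact: measurable_funX.
- by move=> z _; rewrite lee_fin sqr_ge0.
- by apply/measurable_EFinP; exact: measurable_funX.
apply: eq_integral => z _; rewrite -EFinD !patchE; case: ifP => _.
  by rewrite vnorm_sq.
by rewrite expr0n addr0.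
Qed.

Lemma L2norm_eq0 (Om : set (R * R)) f : L2 leb2 Om f ->
  fine (L2norm leb2 Om f) = 0 -> {ae leb2, forall z, Om z -> f z = 0}.
Proof.
move=> Lf f0; have mf : measurable_fun (setT : set (T * T)) (f \_ Om).
  by move: Lf; rewrite /L2 inE => /andP[]; rewrite inE.
have : L2norm leb2 Om f = 0%E by rewrite -(fineK (L2_fin_num Lf)) f0.
move=> /Lnorm_eq0_eq0 H.
have {}H : (EFin \o f \_ Om) = cst 0%E %[ae leb2].
  by apply: H => //; exact/measurable_EFinP.
apply: (@filterS _ _ (ae_filter_ringOfSetsType (@leb2 R)) _ _ _ H) => z /= /(_ I) + Oz.
by rewrite patchE mem_set// => -[].
Qed.

Lemma Loonorm_le (Om : set (R * R)) f (M : R) : 0 <= M ->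
  {ae leb2, forall z, Om z -> `|f z| <= M} -> (Loonorm leb2 Om f <= M%:E)%E.
Proof.
move=> M0 H; rewrite /Loonorm unlock; case: ifP => _; last by rewrite lee_fin.
apply/ess_supP.
apply: (@filterS _ _ (ae_filter_ringOfSetsType (@leb2 R)) _ _ _ H) => z Hz.
rewrite /= lee_fin patchE; case: ifPn => [|_]; last by rewrite normr0.
by rewrite inE => /Hz.
Qed.

(** The square of the H2 norm as a real number: finiteness of all the norms lets the remaining
    estimates take place in [R]. *)
Definition H2sum (Om : set (R * R)) u : R :=
  \sum_(m < 2) (fine (L2norm leb2 Om (u m)) ^+ 2 +
    \sum_(i < 2) fine (L2norm leb2 Om (wD Om i (u m))) ^+ 2 +
    \sum_(i < 2) \sum_(j < 2 | (i <= j)%N)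
      fine (L2norm leb2 Om (wD Om j (wD Om i (u m)))) ^+ 2).

Lemma H2normE (Om : set (R * R)) u : (forall m, sobolev2 Om (u m)) ->
  H2norm Om u = (Num.sqrt (H2sum Om u))%:E.
Proof.
move=> Hu; rewrite /H2norm.
have -> : (\sum_(m < 2)
     (L2norm leb2 Om (u m) `^ 2
      + \sum_(i < 2) L2norm leb2 Om (wD Om i (u m)) `^ 2
      + \sum_(i < 2) \sum_(j < 2 | (i <= j)%N)
          L2norm leb2 Om (wD Om j (wD Om i (u m))) `^ 2) = (H2sum Om u)%:E)%E.
  rewrite /H2sum -sumEFin; apply: eq_bigr => m _.
  have [[Lm Wm] Wmm] := Hu m.
  rewrite !EFinD L2norm_sq// -!sumEFin; congr (_ + _ + _)%E.
    by apply: eq_bigr => i _; rewrite L2norm_sq//; exact: (Wmm i).1.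
  apply: eq_bigr => i _; rewrite -sumEFin; apply: eq_bigr => j _.
  rewrite L2norm_sq//; exact: (wD_weak_partial ((Wmm i).2 j)).1.
rewrite poweR12_sqrt//= lee_fin.
by rewrite /H2sum sumr_ge0// => m _; rewrite !addr_ge0 ?sqr_ge0// sumr_ge0// => i _;
  rewrite ?sqr_ge0// sumr_ge0// => j _; rewrite sqr_ge0.
Qed.

Lemma ler_term_sum (I : finType) (P : pred I) (F : I -> R) (i : I) : P i ->
  (forall j, 0 <= F j) -> F i <= \sum_(j | P j) F j.
Proof. by move=> Pi F0; rewrite (bigD1 i)//= lerDl sumr_ge0. Qed.

Lemma H2sum_ge_L2 (Om : set (R * R)) u :
  fine (L2norm leb2 Om (u ord0)) ^+ 2 + fine (L2norm leb2 Om (u ord_max)) ^+ 2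
  <= H2sum Om u.
Proof.
have -> : (ord_max : 'I_2) = lift ord0 ord0 by exact: val_inj.
apply: (@le_trans _ _ (\sum_(m < 2) fine (L2norm leb2 Om (u m)) ^+ 2)).
  by rewrite !big_ord_recl big_ord0 addr0.
rewrite /H2sum; apply: ler_sum => m _.
by rewrite -addrA lerDl addr_ge0// sumr_ge0// => i _; rewrite ?sqr_ge0// sumr_ge0// => j _;
  rewrite sqr_ge0.
Qed.

Lemma H2sum_ge_second (Om : set (R * R)) u (m i j : 'I_2) : (i <= j)%N ->
  fine (L2norm leb2 Om (wD Om j (wD Om i (u m)))) ^+ 2 <= H2sum Om u.
Proof.
move=> ij; pose c k l := fine (L2norm leb2 Om (wD Om l (wD Om k (u m)))) ^+ 2.
have c0 k l : 0 <= c k l by exact: sqr_ge0.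
apply: (@le_trans _ _ (\sum_(l < 2 | (i <= l)%N) c i l)).
  exact: (@ler_term_sum _ (fun l : 'I_2 => (i <= l)%N) (c i)).
apply: (@le_trans _ _ (\sum_(k < 2) \sum_(l < 2 | (k <= l)%N) c k l)).
  apply: (@ler_term_sum _ xpredT (fun k : 'I_2 => \sum_(l < 2 | (k <= l)%N) c k l) i) => // k.
  by rewrite sumr_ge0.
have b0 k : 0 <= fine (L2norm leb2 Om (u k)) ^+ 2 +
    \sum_(i < 2) fine (L2norm leb2 Om (wD Om i (u k))) ^+ 2 +
    \sum_(i < 2) \sum_(j < 2 | (i <= j)%N)
      fine (L2norm leb2 Om (wD Om j (wD Om i (u k)))) ^+ 2.
  by rewrite !addr_ge0 ?sqr_ge0// sumr_ge0// => ? _; rewrite ?sqr_ge0// sumr_ge0// => ? _;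
    rewrite sqr_ge0.
apply: le_trans (@ler_term_sum _ xpredT _ m isT b0).
by rewrite lerDr addr_ge0 ?sqr_ge0// sumr_ge0// => ? _; rewrite sqr_ge0.
Qed.

End norms.

(** * Choice of the scale and conclusion *)

Section agmon.
Context {R : realType}.
Implicit Types (f g : R * R -> R) (L r : R) (u : 'I_2 -> R * R -> R).

Lemma le_sqrt_of_sq (a y : R) : 0 <= a -> a ^+ 2 <= y -> a <= Num.sqrt y.
Proof.
by move=> a0 ay; rewrite -(ger0_norm a0) -sqrtr_sqr; exact: ler_wsqrtr.
Qed.

(** [N] and [h] merely dominate norms of [f], so the norms of a whole vector field can be used for
    each component. The scale [r = q / 4] with [q = sqrt(N / h)] balances the two terms of
    [agmon_bound]. *)
Lemma ae_le_agmon_product L f (N h : R) : 1 <= L -> sobolev2 (Omega L) f ->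
  0 <= N -> N <= h -> fine (L2norm leb2 (Omega L) f) <= N ->
  (forall i j : 'I_2, (i <= j)%N ->
    fine (L2norm leb2 (Omega L) (wD (Omega L) j (wD (Omega L) i f))) <= h) ->
  {ae leb2, forall z, Omega L z -> `|f z| <= 80 * ramp_bound ^+ 2 * Num.sqrt (N * h)}.
Proof.
have lin (w : R) : 0 < w -> 4 * w + 3 / 4 * w <= 5 * w by lra.
move=> L1 Hf N0 Nh fN fh; have F := ae_filter_ringOfSetsType (@leb2 R).
have [B1 _] := @ramp_boundP R.
have B2 : 0 <= @ramp_bound R ^+ 2 by rewrite sqr_ge0.
(* For [N = 0] the scale would degenerate, but then [f] vanishes almost everywhere. *)
move: N0; rewrite le_eqVlt => /orP[/eqP N0|N0].
  have f0 : fine (L2norm leb2 (Omega L) f) = 0.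
    by apply/eqP; rewrite eq_le fine_ge0 ?Lnorm_ge0// N0 fN.
  have Lf : L2 leb2 (Omega L) f by case: Hf => -[].
  apply: (@filterS _ _ F _ _ _ (L2norm_eq0 Lf f0)) => z Hz Oz.
  by rewrite Hz// normr0; apply: mulr_ge0; [exact: mulr_ge0|exact: sqrtr_ge0].
have h0 : 0 < h by exact: lt_le_trans Nh.
pose q := Num.sqrt (N / h).
have Nh0 : 0 < N / h by rewrite divr_gt0.
have q0 : 0 < q by rewrite sqrtr_gt0.
have qN : q ^+ 2 * h = N by rewrite sqr_sqrtr ?ltW// divfK// gt_eqF.
(* Here [N <= h] keeps the scale [q / 4] within the admissible range. *)
have q1 : q <= 1.
  by rewrite -sqrtr1 ler_wsqrtr// ler_pdivrMr// mul1r.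
have qh : Num.sqrt (N * h) = q * h.
  rewrite -qN (_ : _ * h = (q * h) ^+ 2); last by ring.
  by rewrite sqrtr_sqr ger0_norm// mulr_ge0 ?ltW.
have r0 : 0 < 4^-1 * q <= 4^-1.
  by rewrite mulr_gt0//= ler_piMr.
apply: (@filterS _ _ F _ _ _ (ae_le_agmon_bound L1 r0 Hf)) => z Hz Oz.
apply: le_trans (Hz Oz) _; rewrite qh /agmon_bound.
(* At this scale the two terms are at most [4 q h] and [3/4 q h], together below [5 q h], whence
   [80 = 16 * 5]. *)
rewrite (_ : 80 * _ * _ = 16 * ramp_bound ^+ 2 * (5 * (q * h))); last by ring.
apply: ler_wpM2l; first by rewrite mulr_ge0.
have E1 : fine (L2norm leb2 (Omega L) f) / (4^-1 * q) <= 4 * (q * h).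
  rewrite ler_pdivrMr ?mulr_gt0//.
  have -> : 4 * (q * h) * (4^-1 * q) = q ^+ 2 * h by field.
  by rewrite qN.
have fh2 := lerD (lerD (fh ord0 ord0 isT) (fh ord0 ord_max isT)) (fh ord_max ord_max isT).
have E2 := ler_wpM2l (ltW (andP r0).1) fh2.
have qh0 : 0 < q * h by rewrite mulr_gt0.
have := lerD E1 E2; move=> /le_trans; apply.
rewrite (_ : 4^-1 * q * (h + h + h) = 3 / 4 * (q * h)); last by field.
exact: lin.
Qed.

End agmon.

Theorem lemma3p11 (R : realType) (mu k0 k1 : R) (mu_gt0 : 0 < mu) :
  exists C : R, 0 < C /\
    forall (L : R) (u : 'I_2 -> R * R -> R), 1 <= L -> in_W mu k0 k1 L u ->
      (Loonorm leb2 (Omega L) (vnorm u) `^ 2 <=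
       C%:E * L2norm leb2 (Omega L) (vnorm u) * H2norm (Omega L) u)%E.
Proof.
have [B1 _] := @ramp_boundP R.
(* Each component has square at most [(80 * ramp_bound ^+ 2) ^+ 2 * N * h]; the leading 2 counts the
   components. *)
exists (2 * (80 * ramp_bound ^+ 2) ^+ 2); split.
  by rewrite mulr_gt0// exprn_gt0// mulr_gt0// exprn_gt0// (lt_le_trans ltr01).
move=> L u L1 [_ Hu _].
have Lu i : L2 leb2 (Omega L) (u i) by case: (Hu i) => -[].
pose n f := fine (L2norm leb2 (Omega L) f).
have n0 f : 0 <= n f by rewrite fine_ge0// Lnorm_ge0.
rewrite L2norm_vnorm// H2normE//.
(* [N] is the L2 norm of the field and [h] its H2 norm; both dominate the corresponding norms of
   each component. *)
set N := Num.sqrt _; set h := Num.sqrt _.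
have N0 : 0 <= N by exact: sqrtr_ge0.
have Nh : N <= h by apply: ler_wsqrtr; exact: H2sum_ge_L2.
have nN0 : n (u ord0) <= N by apply: le_sqrt_of_sq => //; rewrite lerDl sqr_ge0.
have nN1 : n (u ord_max) <= N by apply: le_sqrt_of_sq => //; rewrite lerDr sqr_ge0.
have nh m (i j : 'I_2) : (i <= j)%N -> n (wD (Omega L) j (wD (Omega L) i (u m))) <= h.
  by move=> ij; apply: le_sqrt_of_sq => //; exact: H2sum_ge_second.
have H0 := ae_le_agmon_product L1 (Hu ord0) N0 Nh nN0 (nh ord0).
have H1 := ae_le_agmon_product L1 (Hu ord_max) N0 Nh nN1 (nh ord_max).
set M := 80 * ramp_bound ^+ 2 * Num.sqrt (N * h) in H0 H1.
have K0 : 0 <= Num.sqrt (2 * M ^+ 2) by exact: sqrtr_ge0.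
have HK : (Loonorm leb2 (Omega L) (vnorm u) <= (Num.sqrt (2 * M ^+ 2))%:E)%E.
  apply: Loonorm_le => //.
  have F := ae_filter_ringOfSetsType (@leb2 R).
  apply: (@filterS2 _ _ F _ _ _ _ H0 H1) => z h0 h1 Oz.
  rewrite ger0_norm ?sqrtr_ge0//; apply: le_sqrt_of_sq; first exact: sqrtr_ge0.
  rewrite vnorm_sq mulrDl mul1r; apply: lerD.
    by rewrite -real_normK ?num_real// lerXn2r ?nnegrE// ?(le_trans _ (h0 Oz))// h0.
  by rewrite -real_normK ?num_real// lerXn2r ?nnegrE// ?(le_trans _ (h1 Oz))// h1.
apply: (@le_trans _ _ ((Num.sqrt (2 * M ^+ 2))%:E `^ 2)%E).
  by apply: gt0_ler_poweR; rewrite ?in_itv/= ?leey ?andbT ?Lnorm_ge0 ?lee_fin.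
rewrite poweR_EFin powR_mulrn// sqr_sqrtr; last first.
  by apply: mulr_ge0 => //; exact: sqr_ge0.
rewrite -!EFinM lee_fin /M exprMn sqr_sqrtr; last first.
  by apply: mulr_ge0 => //; exact: le_trans Nh.
by rewrite !mulrA.
Qed.
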